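(* Let $\phi:\mathbb{C}_{1/2}\to\mathbb{C}_{1/2}$ be analytic such that the composition operator $C_\phi f=f\circ\phi$ is a continuous operator on $\mathcal{H}$. Then $C_\phi$ is recurrent if and only if $\phi(s)=s+it$ for some $t\in\mathbb{R}$. Moreover, if $C_\phi$ is recurrent, then $C_\phi$ is hyper-recurrent and $\mathrm{Hr}(C_\phi)$ is dense in $\mathcal{H}$.
   Context: $\mathbb{C}_\theta=\{s\in\mathbb{C}:\mathrm{Re}(s)>\theta\}$. $\mathcal{H}$ is the Hardy space of Dirichlet series: the Hilbert space of functions $f(s)=\sum_{n\ge1}a_nn^{-s}$ with $\|f\|=(\sum_n|a_n|^2)^{1/2}<\infty$, viewed as holomorphic functions on $\mathbb{C}_{1/2}$. For a bounded operator $T$: $x$ is recurrent if $T^{\omega_n}x\to x$ for some strictly increasing sequence $(\omega_n)$ of positive integers; $\mathrm{Rec}(T)$ is the set of recurrent vectors and $T$ is recurrent if $\mathrm{Rec}(T)$ is dense. $\mathfrak{C}$ is the set of strictly increasing sequences $\omega$ with $T^{\omega_n}x\to x$ for some $x\ne0$; $\mathfrak{L}(\omega)=\{x:T^{\omega_n}x\to x\}$. $\mathrm{Hr}(T)$ is the set of $x\in\mathrm{Rec}(T)$ such that $\mathfrak{L}(\omega)$ is dense for every $\omega\in\mathfrak{C}$ with $x\in\mathfrak{L}(\omega)$; a recurrent $T$ is hyper-recurrent if $\mathrm{Hr}(T)\ne\emptyset$. *)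

(* Defs.v *)
From Stdlib Require Import Reals.
From Coquelicot Require Import Coquelicot.
Open Scope R_scope.

Definition in_halfplane (theta : R) (s : C) : Prop := theta < Re s.

Definition holomorphic_on_half (f : C -> C) : Prop :=
  forall s : C, in_halfplane (1/2) s ->
    @ex_derive C_AbsRing C_NormedModule f s.

(* m^{-s} = exp(-s log m) for a positive integer m (here m = n+1). *)
Definition npow_neg (m : nat) (s : C) : C :=
  (exp (- Re s * ln (INR m)) * cos (Im s * ln (INR m)),
   - exp (- Re s * ln (INR m)) * sin (Im s * ln (INR m)))%R.

(* Coefficient sequences: a n is the coefficient of (n+1)^{-s}, i.e. the
   Dirichlet series sum_{m>=1} a_{m} m^{-s} is encoded by a with
   a n = a_{n+1}. *)
Definition seqC := nat -> C.

Definition inH (a : seqC) : Prop :=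
  ex_series (fun n => (Cmod (a n) ^ 2)%R).

Definition Hnorm (a : seqC) : R :=
  sqrt (Series (fun n => (Cmod (a n) ^ 2)%R)).

Definition seq_sub (a b : seqC) : seqC := fun n => Cminus (a n) (b n).
Definition seq_zero : seqC := fun _ => 0%C.

Definition dirichlet_has_value (a : seqC) (s v : C) : Prop :=
  @is_series C_AbsRing C_NormedModule
    (fun n => Cmult (a n) (npow_neg (S n) s)) v.

Definition is_bounded_composition_operator (phi : C -> C)
  (T : seqC -> seqC) : Prop :=
  (forall a, inH a -> inH (T a)) /\
  (forall a, inH a -> forall s v, in_halfplane (1/2) s ->
      dirichlet_has_value a (phi s) v -> dirichlet_has_value (T a) s v) /\
  (exists M : R, forall a, inH a -> Hnorm (T a) <= M * Hnorm a).

Definition pos_strict_incr (w : nat -> nat) : Prop :=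
  (1 <= w 0)%nat /\ forall n, (w n < w (S n))%nat.

Definition conv_along (T : seqC -> seqC) (w : nat -> nat) (x : seqC) : Prop :=
  is_lim_seq (fun n => Hnorm (seq_sub (Nat.iter (w n) T x) x)) 0.

Definition Rec (T : seqC -> seqC) (x : seqC) : Prop :=
  inH x /\ exists w, pos_strict_incr w /\ conv_along T w x.

Definition denseH (S : seqC -> Prop) : Prop :=
  forall a, inH a -> forall eps : R, 0 < eps ->
    exists x, S x /\ inH x /\ Hnorm (seq_sub x a) < eps.

Definition recurrent (T : seqC -> seqC) : Prop := denseH (Rec T).

Definition frakC (T : seqC -> seqC) (w : nat -> nat) : Prop :=
  pos_strict_incr w /\
  exists x, inH x /\ x <> seq_zero /\ conv_along T w x.

Definition frakL (T : seqC -> seqC) (w : nat -> nat) (x : seqC) : Prop :=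
  inH x /\ conv_along T w x.

Definition Hr (T : seqC -> seqC) (x : seqC) : Prop :=
  Rec T x /\
  forall w, frakC T w -> frakL T w x -> denseH (frakL T w).

Definition hyper_recurrent (T : seqC -> seqC) : Prop :=
  recurrent T /\ exists x, Hr T x.

(* Main.v *)
(* Write T e_n for the image of the basis vector n^{-s}: it is the Dirichlet
   series of n^{-phi(s)}. Comparing the leading terms of these series as
   Re s tends to infinity shows that T e_n starts with the term of index
   n^c, with the same c for all n.

   - If c = 0, then -Re phi(s) = log |T e_n (s)| / log n does not depend on n,
     and expanding it to the order of 3^{-s} on all lines Im s = tau shows that
     the coefficients of index 2 and 3 of T e_n, divided by the constant one,
     are proportional to log n. So the coefficients of index 2 and 3 are
     linearly dependent on the range of T, which cannot be dense.
   - If c > 1, then the coefficient of index 2 vanishes on the range of T.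
   - If c = 1, the coefficient of index 2 is multiplied by a constant b under T,
     and recurrence forces |b| = 1, whence all T e_n have a unimodular leading
     coefficient. If T e_n has a second coefficient d, then T e_{n^j}, whose
     function is the j-th power of that of T e_n, has a coefficient of modulus
     j |d|, which contradicts boundedness. So T is diagonal and phi(s) - s is
     an imaginary constant.

   Conversely, for a vertical translation T is a diagonal unitary operator. By
   simultaneous Diophantine approximation its powers return to the identity, and
   every vector without zero coefficient belongs to Hr(T), because convergence
   of T^{w_n} on such a vector forces convergence of each eigenvalue to 1. *)

Require Import Defs.
From Stdlib Require Import Reals Lra Lia FunctionalExtensionality Classical
  ClassicalEpsilon List FinFun.
From Coquelicot Require Import Coquelicot.
Open Scope R_scope.

Local Notation Cseries u v := (@is_series C_AbsRing C_NormedModule u v).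

(** * Dirichlet series in the far right half-plane *)

(** The decay rate of the n-th term: the index shift of [seqC] is absorbed here, so that the term
    with coefficient n decays like [exp (- Re s * lnS n)]. *)
Definition lnS (n : nat) : R := ln (INR (S n)).

Lemma lnS_0 : lnS 0 = 0.
Proof. unfold lnS. simpl. apply ln_1. Qed.

Lemma lnS_lt i j : (i < j)%nat -> lnS i < lnS j.
Proof.
  intros H. apply ln_increasing.
  - apply lt_0_INR. lia.
  - apply lt_INR. lia.
Qed.

Lemma lnS_nonneg n : 0 <= lnS n.
Proof.
  destruct n as [|n].
  - rewrite lnS_0. lra.
  - rewrite <- lnS_0. apply Rlt_le, lnS_lt. lia.
Qed.

Lemma lnS_pos n : (0 < n)%nat -> 0 < lnS n.
Proof. intros H. rewrite <- lnS_0. now apply lnS_lt. Qed.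

Lemma lnS_le i j : (i <= j)%nat -> lnS i <= lnS j.
Proof.
  intros H. destruct (Nat.eq_dec i j) as [->|]; [lra|].
  apply Rlt_le, lnS_lt. lia.
Qed.

Lemma lnS_inj i j : lnS i = lnS j -> i = j.
Proof.
  intros H. destruct (Nat.lt_total i j) as [h|[h|h]]; trivial;
    apply lnS_lt in h; lra.
Qed.

Lemma Cmod_npow_neg n s : Cmod (npow_neg (S n) s) = exp (- Re s * lnS n).
Proof.
  unfold npow_neg, Cmod. cbn [fst snd]. fold (lnS n).
  replace (_ + _) with (exp (- Re s * lnS n) ^ 2).
  - apply sqrt_pow2. apply Rlt_le, exp_pos.
  - pose proof (sin2_cos2 (Im s * lnS n)) as H. unfold Rsqr in H.
    set (c := cos _) in *. set (d := sin _) in *.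
    replace (exp (- Re s * lnS n) ^ 2) with (exp (- Re s * lnS n) ^ 2 * (d * d + c * c)).
    + ring.
    + rewrite H. ring.
Qed.

Lemma npow_neg_nonzero n s : npow_neg (S n) s <> 0%C.
Proof. apply Cmod_gt_0. rewrite Cmod_npow_neg. apply exp_pos. Qed.

Lemma npow_neg_plus n s t :
  npow_neg n (s + t)%C = (npow_neg n s * npow_neg n t)%C.
Proof.
  unfold npow_neg. rewrite re_plus, im_plus.
  replace (- (Re s + Re t) * ln (INR n))
    with (- Re s * ln (INR n) + - Re t * ln (INR n)) by ring.
  rewrite Rmult_plus_distr_r, exp_plus, cos_plus, sin_plus.
  unfold Cmult; cbn [fst snd]. f_equal; ring.
Qed.

Lemma npow_neg_mul i j s :
  (0 < i)%nat -> (0 < j)%nat -> npow_neg (i * j) s = (npow_neg i s * npow_neg j s)%C.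
Proof.
  intros Hi Hj.
  unfold npow_neg.
  rewrite mult_INR, ln_mult by (apply lt_0_INR; lia).
  rewrite !Rmult_plus_distr_l, exp_plus, cos_plus, sin_plus.
  unfold Cmult; cbn [fst snd]. f_equal; ring.
Qed.

Lemma npow_neg_1 s : npow_neg 1 s = 1%C.
Proof.
  unfold npow_neg. simpl INR. rewrite ln_1, !Rmult_0_r, exp_0, cos_0, sin_0.
  unfold RtoC. f_equal; ring.
Qed.

Lemma npow_neg_pow i j s :
  (0 < i)%nat -> npow_neg (i ^ j) s = (npow_neg i s ^ j)%C.
Proof.
  intros Hi. induction j as [|j IH]; [apply npow_neg_1|].
  rewrite Nat.pow_succ_r', npow_neg_mul, IH, Cpow_S; trivial.
  assert (i ^ j <> 0)%nat by (apply Nat.pow_nonzero; lia). lia.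
Qed.

(** * Series of complex numbers *)

Lemma Cseries_Cmod_le (u : nat -> C) (v : C) (b : nat -> R) (l : R) :
  Cseries u v -> (forall n, Cmod (u n) <= b n) -> is_series b l -> Cmod v <= l.
Proof.
  intros Hu Hb Hl.
  assert (H1 : is_lim_seq (fun n => Cmod (@sum_n C_AbelianGroup u n)) (Cmod v)).
  { apply (filterlim_comp _ _ _ _ _ _ _ _ Hu). apply (filterlim_norm v). }
  apply (is_lim_seq_le _ _ (Cmod v) l) with (2 := H1) (3 := Hl).
  intros n. eapply Rle_trans; [apply (norm_sum_n_m (V := C_NormedModule))|].
  apply sum_n_m_le. exact Hb.
Qed.

Lemma Cseries_tail (u : nat -> C) (v : C) (k : nat) :
  Cseries u v ->
  Cseries (fun n => u (S k + n)%nat) (v - @sum_n C_AbelianGroup u k)%C.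
Proof.
  intros H. apply (is_series_incr_n (V := C_NormedModule)); [lia|].
  replace (plus _ _) with v; trivial.
  cbn [Init.Nat.pred].
  change (v = (v - @sum_n C_AbelianGroup u k + @sum_n C_AbelianGroup u k)%C). ring.
Qed.

Lemma Cseries_unique (u : nat -> C) (v w : C) : Cseries u v -> Cseries u w -> v = w.
Proof. intros H1 H2. exact (filterlim_locally_unique _ _ _ H1 H2). Qed.

Lemma Cseries_scal c (u : nat -> C) (v : C) :
  Cseries u v -> Cseries (fun n => c * u n)%C (c * v)%C.
Proof. intros H. exact (is_series_scal (V := C_NormedModule) c _ _ H). Qed.

Lemma Cseries_plus (u w : nat -> C) (v z : C) :
  Cseries u v -> Cseries w z -> Cseries (fun n => u n + w n)%C (v + z)%C.
Proof. intros H1 H2. exact (is_series_plus (V := C_NormedModule) _ _ _ _ H1 H2). Qed.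

Lemma Cseries_minus (u w : nat -> C) (v z : C) :
  Cseries u v -> Cseries w z -> Cseries (fun n => u n - w n)%C (v - z)%C.
Proof. intros H1 H2. exact (is_series_minus (V := C_NormedModule) _ _ _ _ H1 H2). Qed.

Lemma Cseries_ext (u w : nat -> C) (v : C) :
  (forall n, u n = w n) -> Cseries u v -> Cseries w v.
Proof. intros H. apply is_series_ext. exact H. Qed.

Lemma Cseries_single (k : nat) (u : nat -> C) :
  (forall n, n <> k -> u n = 0%C) -> Cseries u (u k).
Proof.
  intros H.
  assert (E : forall n, (@sum_n C_AbelianGroup u n : C) = if Nat.leb k n then u k else 0%C).
  { induction n as [|n IH].
    - rewrite sum_O. destruct (Nat.leb_spec k 0).
      + now replace k with 0%nat by lia.
      + apply H. lia.
    - rewrite sum_Sn, IH.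
      change (plus ?x ?y) with (x + y)%C.
      destruct (Nat.leb_spec k n), (Nat.leb_spec k (S n)); try lia.
      + rewrite (H (S n)) by lia. ring.
      + replace k with (S n) by lia. ring.
      + rewrite (H (S n)) by lia. ring. }
  unfold is_series.
  apply (filterlim_ext_loc (fun _ => u k)); [|apply filterlim_const].
  exists k. intros n Hn. rewrite E. now destruct (Nat.leb_spec k n); [|lia].
Qed.

Lemma ex_Cseries (u : nat -> C) (b : nat -> R) :
  (forall n, Cmod (u n) <= b n) -> ex_series b -> exists v, Cseries u v.
Proof.
  intros H1 H2. apply (ex_series_le (V := C_CompleteNormedModule) u b H1 H2).
Qed.

(** * Elementary inequalities and convergence of the zeta series *)

Lemma exp_le_compat x y : x <= y -> exp x <= exp y.
Proof.
  intros [H| ->]; [|lra]. now apply Rlt_le, exp_increasing.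
Qed.

Lemma one_minus_inv_le_ln x : 0 < x -> 1 - / x <= ln x.
Proof.
  intros H. pose proof (exp_ineq1_le (- ln x)) as E.
  rewrite exp_Ropp, exp_ln in E by trivial. lra.
Qed.

Lemma ln_le_pred x : 0 < x -> ln x <= x - 1.
Proof.
  intros H. pose proof (exp_ineq1_le (ln x)) as E. rewrite exp_ln in E; lra.
Qed.

Lemma exp_opp_lnS n : exp (- lnS n) = / INR (S n).
Proof. unfold lnS. rewrite exp_Ropp, exp_ln; trivial. apply lt_0_INR. lia. Qed.

(** This is 1/(n+2) <= log((n+2)/(n+1)), the case x = (n+2)/(n+1) of 1 - 1/x <= log x. *)
Lemma lnS_step n : exp (- lnS (S n)) <= lnS (S n) - lnS n.
Proof.
  rewrite exp_opp_lnS. unfold lnS.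
  assert (0 < INR (S n)) by (apply lt_0_INR; lia).
  assert (E : INR (S (S n)) = INR (S n) + 1) by apply S_INR.
  pose proof (one_minus_inv_le_ln (INR (S (S n)) / INR (S n))) as Hl.
  unfold Rdiv in Hl. rewrite ln_mult, ln_Rinv in Hl; try lra;
    [|apply Rinv_0_lt_compat; lra].
  eapply Rle_trans; [|eapply Rle_trans; [apply Hl|]].
  - right. rewrite E. field. lra.
  - rewrite E. apply Rmult_lt_0_compat; [lra|]. apply Rinv_0_lt_compat; lra.
  - lra.
Qed.

(* With q = p - 1, the terms are dominated by the telescoping differences of
   n^{-q} / q. *)
Lemma ex_series_zeta p : 1 < p -> ex_series (fun n => exp (- p * lnS n)).
Proof.
  intros Hp. apply ex_series_incr_1.
  set (q := p - 1). assert (Hq : 0 < q) by (unfold q; lra).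
  set (t := fun n => exp (- q * lnS n) / q).
  apply (ex_series_le (V := R_CompleteNormedModule) _ (fun n => t n - t (S n))).
  - intros n. change (Rabs (exp (- p * lnS (S n))) <= t n - t (S n)).
    rewrite Rabs_pos_eq by (apply Rlt_le, exp_pos).
    unfold t. apply (Rmult_le_reg_r q); [lra|]. field_simplify; [|lra].
    pose proof (lnS_step n) as H.
    replace (- p * lnS (S n)) with (- q * lnS (S n) + - lnS (S n)) by (unfold q; ring).
    replace (- q * lnS n) with (- q * lnS (S n) + q * (lnS (S n) - lnS n)) by ring.
    rewrite !exp_plus.
    pose proof (exp_ineq1_le (q * (lnS (S n) - lnS n))) as H2.
    pose proof (exp_pos (- q * lnS (S n))) as H3.
    assert (H4 : q * exp (- lnS (S n)) <= q * (lnS (S n) - lnS n))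
      by (apply Rmult_le_compat_l; lra).
    nra.
  - destruct (ex_finite_lim_seq_decr (fun n => t (S n)) 0) as [l Hl].
    + intros n. unfold t, Rdiv. apply Rmult_le_compat_r.
      * apply Rlt_le, Rinv_0_lt_compat. lra.
      * apply Rlt_le, exp_increasing. pose proof (lnS_lt (S n) (S (S n)) ltac:(lia)). nra.
    + intros n. unfold t. apply Rlt_le, Rdiv_lt_0_compat; [apply exp_pos|lra].
    + exists (t 0%nat - l).
      change (is_lim_seq (sum_n (fun n => t n - t (S n))) (t 0%nat - l)).
      apply (is_lim_seq_ext (fun n => t 0%nat - t (S n))).
      * induction n as [|n IH].
        -- rewrite sum_O. reflexivity.
        -- rewrite sum_Sn, <- IH. change (t 0%nat - t (S (S n)) =
             t 0%nat - t (S n) + (t (S n) - t (S (S n)))). ring.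
      * apply is_lim_seq_minus'; [apply is_lim_seq_const|exact Hl].
Qed.

Lemma series_nonneg_term_le (u : nat -> R) (k : nat) :
  (forall n, 0 <= u n) -> ex_series u -> u k <= Series u.
Proof.
  intros Hu [l Hl]. rewrite (is_series_unique _ _ Hl).
  apply Rle_trans with (sum_n u k).
  - destruct k as [|k]; [rewrite sum_O; lra|]. rewrite sum_Sn.
    change (u (S k) <= sum_n u k + u (S k)).
    assert (0 <= sum_n u k); [|lra].
    induction k as [|k IH]; [rewrite sum_O; apply Hu|].
    rewrite sum_Sn. change (0 <= sum_n u k + u (S k)). specialize (Hu (S k)). lra.
  - apply (is_lim_seq_incr_compare (sum_n u) l Hl).
    intros n. rewrite sum_Sn. change (sum_n u n <= sum_n u n + u (S n)).
    specialize (Hu (S n)). lra.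
Qed.

(** * Norm, convergence and tails of Dirichlet series *)

Lemma Hnorm_sqr a : inH a -> Hnorm a ^ 2 = Series (fun n => Cmod (a n) ^ 2).
Proof.
  intros H. unfold Hnorm. rewrite <- Rsqr_pow2. apply Rsqr_sqrt.
  eapply Rle_trans; [|apply (series_nonneg_term_le _ 0 (fun n => pow2_ge_0 (Cmod (a n)))), H].
  apply pow2_ge_0.
Qed.

Lemma Hnorm_nonneg a : 0 <= Hnorm a.
Proof. apply sqrt_pos. Qed.

Lemma coef_le_Hnorm a j : inH a -> Cmod (a j) <= Hnorm a.
Proof.
  intros H.   apply Rsqr_incr_0; [|apply Cmod_ge_0|apply Hnorm_nonneg].
  rewrite !Rsqr_pow2, Hnorm_sqr by trivial.
  apply (series_nonneg_term_le (fun n => Cmod (a n) ^ 2)); trivial.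
  intros n. apply pow2_ge_0.
Qed.

(** Since 2xy <= x^2 + y^2, the terms are dominated by half the sum of |a_n|^2 and (n+1)^{-2 Re s},
    and 2 Re s > 1. *)
Lemma dirichlet_ex_value a s :
  inH a -> in_halfplane (1/2) s -> exists v, dirichlet_has_value a s v.
Proof.
  intros Ha Hs. unfold in_halfplane in Hs.
  apply (ex_Cseries _ (fun n => (Cmod (a n) ^ 2 + exp (- (2 * Re s) * lnS n)) * / 2)).
  - intros n. rewrite Cmod_mult, Cmod_npow_neg.
    replace (- (2 * Re s) * lnS n) with (- Re s * lnS n + - Re s * lnS n) by ring.
    rewrite exp_plus. set (y := exp _). set (x := Cmod _).
    pose proof (pow2_ge_0 (x - y)). lra.
  - apply ex_series_scal_r.
    apply (ex_series_plus (V := R_NormedModule)); [exact Ha|].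
    apply ex_series_zeta. lra.
Qed.

(** Beyond index k the factor (k+2)^{-(Re s - 2)} can be pulled out of every term, which leaves the
    convergent series of n^{-2}; hence the restriction to Re s >= 2. *)
Lemma dirichlet_tail a A k :
  (forall n, Cmod (a n) <= A) ->
  exists K, 0 <= K /\ forall s v, 2 <= Re s -> dirichlet_has_value a s v ->
    Cmod (v - @sum_n C_AbelianGroup (fun n => a n * npow_neg (S n) s) k)%C
      <= K * exp (- Re s * lnS (S k)).
Proof.
  intros HA.
  assert (A0 : 0 <= A) by (eapply Rle_trans; [apply Cmod_ge_0|apply (HA 0%nat)]).
  assert (Z : ex_series (fun n => exp (- (2) * lnS (S k + n)))).
  { apply (ex_series_incr_n (V := R_NormedModule) (fun n => exp (- (2) * lnS n)) (S k)).
    apply (ex_series_zeta 2). lra. }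
  destruct Z as [z Hz].
  assert (Z0 : 0 <= z).
  { rewrite <- (is_series_unique _ _ Hz).
    eapply Rle_trans; [|apply (series_nonneg_term_le _ 0)].
    - apply Rlt_le, exp_pos.
    - intros n. apply Rlt_le, exp_pos.
    - now exists z. }
  exists (A * exp (2 * lnS (S k)) * z). split.
  { pose proof (exp_pos (2 * lnS (S k))). apply Rmult_le_pos; [|lra]. nra. }
  intros s v Hs Hv.
  apply (Cseries_tail _ _ k) in Hv.
  apply (Cseries_Cmod_le _ _
    (fun n => (A * exp (2 * lnS (S k)) * exp (- Re s * lnS (S k))) * exp (- (2) * lnS (S k + n))) _ Hv).
  - intros n. rewrite Cmod_mult, Cmod_npow_neg.
    rewrite !Rmult_assoc. apply Rmult_le_compat.
    + apply Cmod_ge_0.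
    + apply Rlt_le, exp_pos.
    + apply HA.
    + rewrite <- !exp_plus. apply exp_le_compat.
      pose proof (lnS_le (S k) (S k + n) ltac:(lia)). nra.
  - replace (A * exp (2 * lnS (S k)) * z * exp (- Re s * lnS (S k))) with
      (scal (A * exp (2 * lnS (S k)) * exp (- Re s * lnS (S k))) z)
      by (change scal with Rmult; simpl; ring).
    apply (is_series_scal_l (V := R_NormedModule)). exact Hz.
Qed.

(** * Quantities bounded by a decaying exponential *)

Lemma exp_eventually_small K d eps :
  0 < d -> 0 < eps -> exists x0, 2 <= x0 /\ forall x, x0 <= x -> K * exp (- x * d) <= eps.
Proof.
  intros Hd He.
  (* As exp y > y, the quantity is at most |K| / (x d). The floor 2 keeps x in the range of the tail
     estimate. *)
  exists (Rmax 2 (Rabs K / (eps * d))). split; [apply Rmax_l|].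
  intros x Hx.
  assert (H1 : Rabs K / (eps * d) <= x) by (eapply Rle_trans; [apply Rmax_r|exact Hx]).
  assert (Hed : 0 < eps * d) by nra.
  assert (H2 : Rabs K <= eps * (x * d)).
  { apply (Rmult_le_compat_r (eps * d)) in H1; [|lra].
    unfold Rdiv in H1. rewrite Rmult_assoc, Rinv_l in H1; lra. }
  replace (- x * d) with (- (x * d)) by ring.
  rewrite exp_Ropp.
  pose proof (exp_pos (x * d)). pose proof (exp_ineq1_le (x * d)).
  pose proof (Rle_abs K).
  apply (Rmult_le_reg_r (exp (x * d))); trivial.
  rewrite Rmult_assoc, Rinv_l by lra. nra.
Qed.

Lemma exp_small_nonpos x K d x0 :
  0 < d -> (forall y, x0 <= y -> x <= K * exp (- y * d)) -> x <= 0.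
Proof.
  intros Hd H. apply le_epsilon. intros eps He.
  destruct (exp_eventually_small K d eps Hd He) as (x1 & _ & H1).
  specialize (H (Rmax x0 x1) (Rmax_l _ _)). specialize (H1 _ (Rmax_r x0 x1)). lra.
Qed.

Lemma exp_small_zero x K d x0 :
  0 < d -> (forall y, x0 <= y -> Rabs x <= K * exp (- y * d)) -> x = 0.
Proof.
  intros Hd H. apply (exp_small_nonpos _ _ _ _ Hd) in H.
  pose proof (Rabs_pos x). apply Rabs_eq_0. lra.
Qed.

Lemma affine_exp_small_zero a b K d x0 :
  0 < d -> 0 <= K -> (forall y, x0 <= y -> Rabs (a * y + b) <= K * exp (- y * d)) ->
  a = 0 /\ b = 0.
Proof.
  intros Hd HK H.
  assert (Ha : a = 0).
  (* The slope is the difference of the values at y + 1 and y, so it is bounded by 2K exp(-y d) for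
     all large y. *)
  { apply (exp_small_zero _ (K + K) d x0 Hd). intros y Hy.
    pose proof (H y Hy) as H1. pose proof (H (y + 1) ltac:(lra)) as H2.
    assert (H3 : K * exp (- (y + 1) * d) <= K * exp (- y * d)).
    { apply Rmult_le_compat_l; trivial. apply exp_le_compat. nra. }
    replace a with ((a * (y + 1) + b) - (a * y + b)) by ring.
    unfold Rminus. eapply Rle_trans; [apply Rabs_triang|]. rewrite Rabs_Ropp. lra. }
  split; trivial. subst a.
  apply (exp_small_zero _ K d x0 Hd). intros y Hy. specialize (H y Hy).
  now rewrite Rmult_0_l, Rplus_0_l in H.
Qed.

(** The coefficients are peeled off in order: after division by the slowest exponential still
    present, its coefficient is bounded by decaying terms only. *)
Lemma three_exp_small_zero a0 a1 a2 K d1 d2 d3 x0 :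
  0 < d1 < d2 -> d2 < d3 -> 0 <= x0 ->
  (forall y, x0 <= y ->
     Rabs (a0 + a1 * exp (- y * d1) + a2 * exp (- y * d2)) <= K * exp (- y * d3)) ->
  a0 = 0 /\ a1 = 0 /\ a2 = 0.
Proof.
  intros H1 H2 H0 H.
  assert (HK : 0 <= K).
  { specialize (H x0 (Rle_refl _)). pose proof (exp_pos (- x0 * d3)).
    pose proof (Rabs_pos (a0 + a1 * exp (- x0 * d1) + a2 * exp (- x0 * d2))). nra. }
  assert (E : forall y p q, 0 <= y -> p <= q -> exp (- y * q) <= exp (- y * p))
    by (intros y p q Hy Hpq; apply exp_le_compat; nra).
  assert (Z0 : a0 = 0).
  { apply (exp_small_zero _ (K + Rabs a1 + Rabs a2) d1 x0); [lra|].
    intros y Hy. specialize (H y Hy).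
    pose proof (E y d1 d2 ltac:(lra) ltac:(lra)). pose proof (E y d1 d3 ltac:(lra) ltac:(lra)).
    pose proof (exp_pos (- y * d1)). pose proof (exp_pos (- y * d2)).
    revert H. pose proof (Rabs_pos a1). pose proof (Rabs_pos a2).
    unfold Rabs; repeat destruct (Rcase_abs _); intros; nra. }
  subst a0.
  assert (Z1 : a1 = 0).
  { apply (exp_small_zero _ (K + Rabs a2) (d2 - d1) x0); [lra|].
    intros y Hy. specialize (H y Hy).
    apply (Rmult_le_reg_r (exp (- y * d1))); [apply exp_pos|].
    rewrite !Rmult_assoc, <- exp_plus.
    replace (- y * (d2 - d1) + - y * d1) with (- y * d2) by ring.
    pose proof (E y d2 d3 ltac:(lra) ltac:(lra)).
    pose proof (exp_pos (- y * d1)). pose proof (exp_pos (- y * d2)).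
    revert H. pose proof (Rabs_pos a2).
    unfold Rabs; repeat destruct (Rcase_abs _); intros; nra. }
  subst a1. repeat split.
  apply (exp_small_zero _ K (d3 - d2) x0); [lra|].
  intros y Hy. specialize (H y Hy).
  apply (Rmult_le_reg_r (exp (- y * d2))); [apply exp_pos|].
  rewrite !Rmult_assoc, <- exp_plus.
  replace (- y * (d3 - d2) + - y * d2) with (- y * d3) by ring.
  eapply Rle_trans; [|exact H].
  rewrite <- (Rabs_pos_eq (exp (- y * d2))) at 1 by apply Rlt_le, exp_pos.
  rewrite <- Rabs_mult. right. f_equal. ring.
Qed.

(** Write |1 + z|^2 = 1 + y with y = 2 Re z + |z|^2 and bound log(1 + y) on both sides by 1 - 1/x <=
    log x <= x - 1. The condition |z| <= 1/4 keeps |y| at most 9/16. *)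
Lemma ln_Cmod_expansion z :
  Cmod z <= / 4 -> Rabs (ln (Cmod (1 + z)) - Re z) <= 6 * Cmod z ^ 2.
Proof.
  intros Hz.
  pose proof (Cmod_ge_0 z) as H0.
  pose proof (re_le_Cmod z) as H1. apply Rabs_le_between in H1.
  set (y := 2 * Re z + Cmod z ^ 2).
  assert (E : Cmod (1 + z)%C ^ 2 = 1 + y).
  { unfold y. rewrite !Cmod2_alt, re_plus, im_plus, re_RtoC, im_RtoC. ring. }
  assert (Hy : - (9/16) <= y <= 9/16) by (unfold y; nra).
  assert (L : ln (1 + y) = 2 * ln (Cmod (1 + z))).
  { rewrite <- E. replace 2 with (INR 2) by (simpl; ring). apply ln_pow.
    apply Cmod_gt_0. intros C0. rewrite C0, Cmod_0 in E. lra. }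
  pose proof (ln_le_pred (1 + y) ltac:(lra)) as L1.
  pose proof (one_minus_inv_le_ln (1 + y) ltac:(lra)) as L2.
  (* The right side is y - y^2 / (1 + y), and 1 + y >= 7/16. *)
  assert (L3 : y - 16/7 * y ^ 2 <= 1 - / (1 + y)).
  { apply (Rmult_le_reg_r (1 + y)); [lra|].
    replace ((1 - / (1 + y)) * (1 + y)) with y by (field; lra). nra. }
  assert (L4 : y ^ 2 <= 81 / 16 * Cmod z ^ 2).
  { assert (- (9/4 * Cmod z) <= y <= 9/4 * Cmod z) by (unfold y; nra). nra. }
  pose proof (pow2_ge_0 (Cmod z)).
  apply Rabs_le_between. rewrite L in L1, L2. unfold y in *. lra.
Qed.

(** * Leading terms and uniqueness of coefficients *)

Lemma sum_n_leading (u : nat -> C) k :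
  (forall i, (i < k)%nat -> u i = 0%C) -> (@sum_n C_AbelianGroup u k : C) = u k.
Proof.
  intros H. destruct k as [|k]; [now rewrite sum_O|].
  rewrite sum_Sn. change (plus ?x ?y) with (x + y)%C.
  assert (E : (@sum_n C_AbelianGroup u k : C) = 0%C); [|rewrite E; ring].
  induction k as [|k IH].
  - rewrite sum_O. apply H. lia.
  - rewrite sum_Sn. change (plus ?x ?y) with (x + y)%C.
    rewrite IH, H; [ring|lia|]. intros i Hi. apply H. lia.
Qed.

Lemma dirichlet_leading_term a A k :
  (forall n, Cmod (a n) <= A) -> (forall i, (i < k)%nat -> a i = 0%C) ->
  exists K, 0 <= K /\ forall s v, 2 <= Re s -> dirichlet_has_value a s v ->
    Cmod (v - a k * npow_neg (S k) s)%C <= K * exp (- Re s * lnS (S k)).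
Proof.
  intros HA Hk. destruct (dirichlet_tail a A k HA) as (K & K0 & HK).
  exists K. split; trivial. intros s v Hs Hv.
  specialize (HK s v Hs Hv). rewrite sum_n_leading in HK; trivial.
  intros i Hi. rewrite Hk by trivial. ring.
Qed.

(** Strong induction: once the earlier coefficients are zero, the term of index i differs from the
    value by O((i+2)^{-x}), and the value itself decays faster than (k+1)^{-x}. Both rates exceed
    [lnS i], with margin d. *)
Lemma dirichlet_coef_vanish a A k K eta :
  (forall n, Cmod (a n) <= A) -> lnS k < eta -> 0 <= K ->
  (forall x : R, 2 <= x -> exists v,
     dirichlet_has_value a x v /\ Cmod v <= K * exp (- x * eta)) ->
  forall i, (i <= k)%nat -> a i = 0%C.
Proof.
  intros HA Heta HK H i.
  induction i as [i IH] using (well_founded_induction Wf_nat.lt_wf). intros Hi.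
  destruct (dirichlet_leading_term a A i HA) as (K' & K'0 & HK').
  { intros j Hj. apply IH; [trivial|lia]. }
  set (d := Rmin eta (lnS (S i)) - lnS i).
  pose proof (lnS_le i k Hi). pose proof (lnS_lt i (S i) ltac:(lia)).
  assert (Hd : 0 < d) by (unfold d; apply Rmin_case; lra).
  apply Cmod_eq_0. pose proof (Cmod_ge_0 (a i)) as C0.
  cut (Cmod (a i) <= 0); [lra|].
  apply (exp_small_nonpos _ (K + K') d 2 Hd). intros x Hx.
  destruct (H x Hx) as (v & Hv & Hv').
  specialize (HK' x v Hx Hv). cbn [Re RtoC fst] in HK'.
  apply (Rmult_le_reg_r (exp (- x * lnS i))); [apply exp_pos|].
  rewrite Rmult_assoc, <- exp_plus.
  replace (- x * d + - x * lnS i) with (- x * Rmin eta (lnS (S i))) by (unfold d; ring).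
  replace (exp (- x * lnS i)) with (Cmod (npow_neg (S i) x)) by now rewrite Cmod_npow_neg.
  rewrite <- Cmod_mult.
  replace (a i * npow_neg (S i) x)%C with (v + - (v - a i * npow_neg (S i) x))%C by ring.
  eapply Rle_trans; [apply Cmod_triangle|]. rewrite Cmod_opp, Rmult_plus_distr_r.
  apply Rplus_le_compat.
  - eapply Rle_trans; [exact Hv'|]. apply Rmult_le_compat_l; trivial.
    apply exp_le_compat. pose proof (Rmin_l eta (lnS (S i))). nra.
  - eapply Rle_trans; [exact HK'|]. apply Rmult_le_compat_l; trivial.
    apply exp_le_compat. pose proof (Rmin_r eta (lnS (S i))). nra.
Qed.

Lemma dirichlet_zero_unique a A :
  (forall n, Cmod (a n) <= A) ->
  (forall x : R, 2 <= x -> dirichlet_has_value a x 0%C) -> forall i, a i = 0%C.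
Proof.
  intros HA H i.
  apply (dirichlet_coef_vanish a A i 0 (lnS i + 1)); trivial; try lra.
  intros x Hx. exists 0%C. split; [auto|]. rewrite Cmod_0. lra.
Qed.

(** A composition operator is specified through values; this lemma turns equality of values into
    equality of coefficients. *)
Lemma dirichlet_unique a b :
  inH a -> inH b ->
  (forall x : R, 2 <= x -> exists v, dirichlet_has_value a x v /\ dirichlet_has_value b x v) ->
  forall i, a i = b i.
Proof.
  intros Ha Hb H i.
  assert (E : (a i - b i)%C = 0%C).
  { apply (dirichlet_zero_unique (seq_sub a b) (Hnorm a + Hnorm b)).
    - intros n. unfold seq_sub, Cminus. eapply Rle_trans; [apply Cmod_triangle|].
      rewrite Cmod_opp. apply Rplus_le_compat; now apply coef_le_Hnorm.
    - intros x Hx. destruct (H x Hx) as (v & Hv & Hv').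
      replace (RtoC 0) with (v - v)%C by ring.
      apply (Cseries_ext (fun n => a n * npow_neg (S n) x - b n * npow_neg (S n) x)%C).
      + intros n. unfold seq_sub. ring.
      + now apply Cseries_minus. }
  replace (a i) with (a i - b i + b i)%C by ring. rewrite E. ring.
Qed.

Lemma first_nonzero (a : seqC) :
  (forall i, a i = 0%C) \/
  exists k, a k <> 0%C /\ forall i, (i < k)%nat -> a i = 0%C.
Proof.
  destruct (classic (exists k, a k <> 0%C)) as [[k Hk]|H].
  - right. induction k as [k IH] using (well_founded_induction Wf_nat.lt_wf).
    destruct (classic (exists j, (j < k)%nat /\ a j <> 0%C)) as [(j & Hj & Hj')|N].
    + now apply (IH j).
    + exists k. split; trivial. intros i Hi. apply NNPP. intros Hn. apply N. now exists i.
  - left. intros i. apply NNPP. intros Hn. apply H. now exists i.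
Qed.

(** * Coefficients of the images of the basis vectors *)

(** The basis vector (n+1)^{-s}; in particular [unit_seq 0] is the constant function 1, which a
    composition operator fixes. *)
Definition unit_seq (n : nat) : seqC := fun m => if Nat.eqb m n then 1%C else 0%C.

Lemma unit_seq_same n : unit_seq n n = 1%C.
Proof. unfold unit_seq. now rewrite Nat.eqb_refl. Qed.

Lemma unit_seq_other n m : m <> n -> unit_seq n m = 0%C.
Proof. intros H. unfold unit_seq. now destruct (Nat.eqb_spec m n). Qed.

Lemma is_series_unit_seq n : is_series (fun m => Cmod (unit_seq n m) ^ 2) 1.
Proof.
  apply (is_series_decr_n (V := R_NormedModule) _ (S n)); [lia|].
  apply (is_series_ext (fun _ => 0)).
  - intros m. rewrite unit_seq_other by lia. rewrite Cmod_0. change (0 = 0 ^ 2). ring.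
  - replace (plus _ _) with 0.
    + apply (filterlim_ext (fun _ => 0)); [|apply filterlim_const].
      intros k. rewrite sum_n_const. ring.
    + cbn [Init.Nat.pred]. change (0 = 1 - sum_n (fun m => Cmod (unit_seq n m) ^ 2) n).
      destruct n as [|n].
      * rewrite sum_O, unit_seq_same, Cmod_1. ring.
      * rewrite sum_Sn, unit_seq_same, Cmod_1. change (plus ?x ?y) with (x + y).
        rewrite (sum_n_ext_loc _ (fun _ => 0)).
        -- rewrite sum_n_const. ring.
        -- intros k Hk. rewrite unit_seq_other by lia. rewrite Cmod_0. change (0 ^ 2 = 0). ring.
Qed.

Lemma inH_unit_seq n : inH (unit_seq n).
Proof. exists 1. apply is_series_unit_seq. Qed.

Lemma Hnorm_unit_seq n : Hnorm (unit_seq n) = 1.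
Proof. unfold Hnorm. rewrite (is_series_unique _ _ (is_series_unit_seq n)). apply sqrt_1. Qed.

Lemma dirichlet_unit_seq n s : dirichlet_has_value (unit_seq n) s (npow_neg (S n) s).
Proof.
  unfold dirichlet_has_value.
  replace (npow_neg (S n) s) with (unit_seq n n * npow_neg (S n) s)%C at 1
    by (rewrite unit_seq_same; ring).
  apply (Cseries_single n (fun m => unit_seq n m * npow_neg (S m) s)%C).
  intros m Hm. rewrite unit_seq_other by trivial. ring.
Qed.

Lemma inH_le a b : (forall n, Cmod (a n) <= Cmod (b n)) -> inH b -> inH a.
Proof.
  intros H. apply (ex_series_le (V := R_CompleteNormedModule)).
  intros n. change (Rabs (Cmod (a n) ^ 2) <= Cmod (b n) ^ 2).
  rewrite Rabs_pos_eq by apply pow2_ge_0. apply pow_incr. split; [apply Cmod_ge_0|apply H].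
Qed.

Lemma Hnorm_le a b : (forall n, Cmod (a n) <= Cmod (b n)) -> inH b -> Hnorm a <= Hnorm b.
Proof.
  intros H Hb. apply sqrt_le_1_alt, Series_le; trivial.
  intros n. split; [apply pow2_ge_0|]. apply pow_incr. split; [apply Cmod_ge_0|apply H].
Qed.

Lemma inH_scal c a : inH a -> inH (fun n => c * a n)%C.
Proof.
  intros H. unfold inH. apply (ex_series_ext (fun n => Cmod c ^ 2 * Cmod (a n) ^ 2)).
  - intros n. rewrite Cmod_mult. symmetry. apply Rpow_mult_distr.
  - now apply (ex_series_scal (V := R_NormedModule) (Cmod c ^ 2)).
Qed.

Lemma inH_plus a b : inH a -> inH b -> inH (fun n => a n + b n)%C.
Proof.
  intros Ha Hb.
  apply (ex_series_le (V := R_CompleteNormedModule) _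
    (fun n => 2 * (Cmod (a n) ^ 2 + Cmod (b n) ^ 2))).
  - intros n. change (Rabs (Cmod (a n + b n) ^ 2) <= 2 * (Cmod (a n) ^ 2 + Cmod (b n) ^ 2)).
    rewrite Rabs_pos_eq by apply pow2_ge_0.
    pose proof (Cmod_triangle (a n) (b n)). pose proof (Cmod_ge_0 (a n + b n)).
    pose proof (pow2_ge_0 (Cmod (a n) - Cmod (b n))).
    apply Rle_trans with ((Cmod (a n) + Cmod (b n)) ^ 2); [apply pow_incr; lra|lra].
  - apply (ex_series_scal (V := R_NormedModule) 2).
    now apply (ex_series_plus (V := R_NormedModule)).
Qed.

Lemma inH_seq_sub a b : inH a -> inH b -> inH (seq_sub a b).
Proof.
  intros Ha Hb. unfold seq_sub, Cminus.
  apply (inH_plus a (fun n => - b n)%C); trivial.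
  apply (inH_le _ b); trivial. intros n. rewrite Cmod_opp. lra.
Qed.

Lemma Hnorm_tail_lim a :
  inH a -> is_lim_seq (fun N => Hnorm (fun m => if Nat.leb m N then 0%C else a m)) 0.
Proof.
  intros Ha. set (u := fun n => Cmod (a n) ^ 2).
  apply (is_lim_seq_ext (fun N => sqrt (Series u - sum_n u N))).
  - intros N. unfold Hnorm. f_equal.
    rewrite (Series_incr_n u (S N)) by (lia || exact Ha).
    cbn [Init.Nat.pred]. rewrite <- sum_n_Reals.
    rewrite (Series_incr_n_aux (fun n => Cmod (if Nat.leb n N then 0%C else a n) ^ 2) (S N)).
    + rewrite Rplus_comm. unfold Rminus. rewrite Rplus_assoc, Rplus_opp_r, Rplus_0_r.
      apply Series_ext. intros n. now destruct (Nat.leb_spec (S N + n) N); [lia|].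
    + intros k Hk. destruct (Nat.leb_spec k N); [|lia]. rewrite Cmod_0. ring.
  - replace (Finite 0) with (Finite (sqrt 0)) by now rewrite sqrt_0.
    apply (is_lim_seq_continuous sqrt); [apply continuity_pt_sqrt; lra|].
    replace 0 with (Series u - Series u) by ring.
    apply is_lim_seq_minus'; [apply is_lim_seq_const|].
    exact (Series_correct u Ha).
Qed.

Lemma in_halfplane_real (x : R) : 2 <= x -> in_halfplane (1/2) x.
Proof. intros H. unfold in_halfplane. cbn. lra. Qed.

(** * Expansions of the logarithm of the modulus *)

Definition leading_index (a : seqC) (k : nat) : Prop :=
  a k <> 0%C /\ forall i, (i < k)%nat -> a i = 0%C.

(** The value is the leading term times 1 + z, where z is of order ((k+2)/(k+1))^{-x}. From x0 on
    |z| <= 1/4, so that log|1 + z| is controlled by |z|. *)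
Lemma ln_dirichlet_leading a A k :
  (forall n, Cmod (a n) <= A) -> leading_index a k ->
  exists K x0, 0 <= K /\ 2 <= x0 /\ forall (x : R) v, x0 <= x -> dirichlet_has_value a x v ->
    Rabs (ln (Cmod v) - (ln (Cmod (a k)) - x * lnS k)) <= K * exp (- x * (lnS (S k) - lnS k)).
Proof.
  intros HA [Hk Hk0].
  destruct (dirichlet_leading_term a A k HA Hk0) as (K & K0 & HK).
  assert (Hd : 0 < lnS (S k) - lnS k) by (pose proof (lnS_lt k (S k) ltac:(lia)); lra).
  assert (Pa : 0 < Cmod (a k)) by now apply Cmod_gt_0.
  set (K1 := K / Cmod (a k)).
  destruct (exp_eventually_small K1 _ (/ 4) Hd ltac:(lra)) as (x0 & Hx0 & Hs).
  (* For |z| <= 1/4 the modulus of log|1 + z| is at most |z| + 6 |z|^2 <= 5/2 |z|. *)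
  exists (3 * K1), x0. repeat split; trivial.
  { unfold K1. apply Rmult_le_pos; [lra|]. apply Rmult_le_pos; [lra|].
    apply Rlt_le, Rinv_0_lt_compat. lra. }
  intros x v Hx Hv. specialize (Hs x Hx).
  specialize (HK x v ltac:(cbn; lra) Hv). cbn [Re RtoC fst] in HK.
  set (w := (a k * npow_neg (S k) x)%C) in *.
  assert (W0 : w <> 0%C) by (apply Cmult_neq_0; [trivial|apply npow_neg_nonzero]).
  assert (Wm : Cmod w = Cmod (a k) * exp (- x * lnS k)).
  { unfold w. rewrite Cmod_mult, Cmod_npow_neg. reflexivity. }
  set (z := ((v - w) / w)%C).
  assert (Ev : v = (w * (1 + z))%C) by (unfold z; field; trivial).
  assert (Hz : Cmod z <= K1 * exp (- x * (lnS (S k) - lnS k))).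
  { unfold z. rewrite Cmod_div by trivial. rewrite Wm.
    pose proof (exp_pos (- x * lnS k)).
    apply (Rmult_le_reg_r (Cmod (a k) * exp (- x * lnS k))); [nra|].
    unfold Rdiv. rewrite Rmult_assoc, Rinv_l, Rmult_1_r by nra.
    eapply Rle_trans; [exact HK|]. right.
    replace (- x * lnS (S k)) with (- x * (lnS (S k) - lnS k) + - x * lnS k) by ring.
    rewrite exp_plus. unfold K1. field. lra. }
  assert (Hz4 : Cmod z <= / 4) by lra.
  pose proof (ln_Cmod_expansion z Hz4) as L.
  pose proof (re_le_Cmod z) as Rz. pose proof (Cmod_ge_0 z) as Cz.
  assert (P1 : 0 < Cmod (1 + z)).
  { pose proof (Cmod_triangle (1 + z) (- z)) as Tr.
    replace (1 + z + - z)%C with (RtoC 1) in Tr by ring.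
    rewrite Cmod_1, Cmod_opp in Tr. lra. }
  assert (El : ln (Cmod v) = ln (Cmod (a k)) - x * lnS k + ln (Cmod (1 + z))).
  { rewrite Ev, Cmod_mult, Wm, !ln_mult; trivial; try apply exp_pos.
    - rewrite ln_exp. ring.
    - apply Rmult_lt_0_compat; trivial. apply exp_pos. }
  rewrite El.
  match goal with |- Rabs ?q <= _ => replace q with (ln (Cmod (1 + z))) by ring end.
  apply Rabs_le_between in L. apply Rabs_le_between in Rz.
  apply Rabs_le_between. nra.
Qed.

(** Relative to the constant term the value is 1 + z, and log|1 + z| = Re z + O(|z|^2). The square
    is of order 2^{-2x} = 4^{-x}, the size of the first omitted term, so only the terms of 2^{-s}
    and 3^{-s} survive. *)
Lemma ln_dirichlet_second_order a A tau :
  (forall n, Cmod (a n) <= A) -> a 0%nat <> 0%C ->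
  exists K x0, 0 <= K /\ 2 <= x0 /\ forall (x : R) v, x0 <= x -> dirichlet_has_value a (x, tau) v ->
    Rabs (ln (Cmod v) - ln (Cmod (a 0%nat))
      - Re (a 1%nat / a 0%nat * npow_neg 2 (x, tau))%C
      - Re (a 2%nat / a 0%nat * npow_neg 3 (x, tau))%C) <= K * exp (- x * lnS 3).
Proof.
  intros HA H0.
  destruct (dirichlet_tail a A 2 HA) as (K & K0 & HK).
  assert (Pa : 0 < Cmod (a 0%nat)) by now apply Cmod_gt_0.
  set (K1 := K / Cmod (a 0%nat)).
  set (D1 := (a 1%nat / a 0%nat)%C). set (D2 := (a 2%nat / a 0%nat)%C).
  set (K2 := Cmod D1 + Cmod D2 + K1).
  assert (HK1 : 0 <= K1).
  { unfold K1. apply Rmult_le_pos; [lra|]. apply Rlt_le, Rinv_0_lt_compat. lra. }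
  pose proof (Cmod_ge_0 D1). pose proof (Cmod_ge_0 D2).
  assert (l1 : 0 < lnS 1) by (apply lnS_pos; lia).
  destruct (exp_eventually_small K2 _ (/ 4) l1 ltac:(lra)) as (x0 & Hx0 & Hs).
  exists (K1 + 6 * K2 ^ 2), x0. repeat split; trivial.
  { pose proof (pow2_ge_0 K2). lra. }
  intros x v Hx Hv. specialize (Hs x Hx).
  specialize (HK (x, tau) v ltac:(cbn; lra) Hv). cbn [Re fst] in HK.
  set (p2 := npow_neg 2 (x, tau)) in *. set (p3 := npow_neg 3 (x, tau)) in *.
  assert (M2 : Cmod p2 = exp (- x * lnS 1)) by apply (Cmod_npow_neg 1 (x, tau)).
  assert (M3 : Cmod p3 = exp (- x * lnS 2)) by apply (Cmod_npow_neg 2 (x, tau)).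
  set (e := (v / a 0%nat - 1 - D1 * p2 - D2 * p3)%C).
  assert (He : Cmod e <= K1 * exp (- x * lnS 3)).
  { replace e with ((v - (a 0%nat + a 1%nat * p2 + a 2%nat * p3)) / a 0%nat)%C
      by (unfold e, D1, D2; field; trivial).
    rewrite Cmod_div by trivial.
    unfold K1, Rdiv. rewrite Rmult_assoc, (Rmult_comm (/ _)), <- Rmult_assoc.
    apply Rmult_le_compat_r; [apply Rlt_le, Rinv_0_lt_compat; lra|].
    rewrite !sum_Sn, sum_O in HK. rewrite npow_neg_1 in HK.
    change (@plus C_AbelianGroup ?x ?y) with (x + y)%C in HK.
    now rewrite Cmult_1_r in HK. }
  set (z := (D1 * p2 + D2 * p3 + e)%C).
  assert (Ev : v = (a 0%nat * (1 + z))%C) by (unfold z, e; field; trivial).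
  assert (Hz : Cmod z <= K2 * exp (- x * lnS 1)).
  { unfold z. eapply Rle_trans; [apply Cmod_triangle|].
    eapply Rle_trans; [apply Rplus_le_compat_r, Cmod_triangle|].
    rewrite !Cmod_mult, M2, M3.
    assert (exp (- x * lnS 2) <= exp (- x * lnS 1))
      by (apply exp_le_compat; pose proof (lnS_le 1 2 ltac:(lia)); nra).
    assert (exp (- x * lnS 3) <= exp (- x * lnS 1))
      by (apply exp_le_compat; pose proof (lnS_le 1 3 ltac:(lia)); nra).
    unfold K2. nra. }
  assert (Hz4 : Cmod z <= / 4) by lra.
  pose proof (ln_Cmod_expansion z Hz4) as L.
  pose proof (Cmod_ge_0 z) as Cz.
  assert (P1 : 0 < Cmod (1 + z)).
  { pose proof (Cmod_triangle (1 + z) (- z)) as Tr.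
    replace (1 + z + - z)%C with (RtoC 1) in Tr by ring.
    rewrite Cmod_1, Cmod_opp in Tr. lra. }
  assert (El : ln (Cmod v) = ln (Cmod (a 0%nat)) + ln (Cmod (1 + z))).
  { now rewrite Ev, Cmod_mult, ln_mult. }
  assert (l3 : lnS 3 = lnS 1 + lnS 1).
  { unfold lnS. rewrite <- ln_mult by (apply lt_0_INR; lia). f_equal. simpl. ring. }
  assert (Hz2 : Cmod z ^ 2 <= K2 ^ 2 * exp (- x * lnS 3)).
  { replace (- x * lnS 3) with (- x * lnS 1 + - x * lnS 1) by (rewrite l3; ring).
    rewrite exp_plus.
    replace (K2 ^ 2 * (exp (- x * lnS 1) * exp (- x * lnS 1)))
      with ((K2 * exp (- x * lnS 1)) ^ 2) by ring.
    apply pow_incr. lra. }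
  assert (Er : Re z = Re (D1 * p2)%C + Re (D2 * p3)%C + Re e) by (unfold z; now rewrite !re_plus).
  pose proof (re_le_Cmod e) as Re_e.
  rewrite El.
  match goal with |- Rabs ?q <= _ =>
    replace q with ((ln (Cmod (1 + z)) - Re z) + Re e) by (rewrite Er; ring) end.
  eapply Rle_trans; [apply Rabs_triang|]. lra.
Qed.

(** With x = tau log n this is n^{-i tau}, the unimodular factor of n^{-s} on the line Im s =
    tau. *)
Definition rotation (x : R) : C := (cos x, - sin x).

Lemma Re_rotation_zero X l :
  0 < l ->
  (forall tau, Re (X * rotation (tau * l))%C = 0) -> X = 0%C.
Proof.
  intros Hl H.
  (* The angle 0 yields the real part of X, the angle pi/2 its imaginary part. *)
  pose proof (H 0) as H0. pose proof (H (PI / 2 / l)) as H1.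
  unfold rotation in H0, H1. rewrite Rmult_0_l, cos_0, sin_0 in H0.
  replace (PI / 2 / l * l) with (PI / 2) in H1 by (field; lra).
  rewrite cos_PI2, sin_PI2 in H1.
  destruct X as [a b]. cbn in H0, H1. unfold RtoC. f_equal; lra.
Qed.

Lemma npow_neg_polar n x tau :
  npow_neg (S n) (x, tau) = (exp (- x * lnS n) * rotation (tau * lnS n))%C.
Proof.
  unfold npow_neg, rotation, Cmult. cbn [Re Im RtoC fst snd]. fold (lnS n). f_equal; ring.
Qed.

Lemma exp_INR_mult k x : exp (INR k * x) = exp x ^ k.
Proof.
  induction k as [|k IH]; [now rewrite Rmult_0_l, exp_0|].
  rewrite S_INR, Rmult_plus_distr_r, exp_plus, IH, Rmult_1_l. simpl. ring.
Qed.

(** The first-order binomial expansion of (P + Q + W)^{j+1}, with p, q, r the decay rates of leading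
    term, second term and rest. The margin eta below both gaps makes the terms with Q^2 or W
    negligible against P^j Q. *)
Lemma power_second_order (P Q W u : R -> C) (p q r eta K KP KQ : R) :
  (forall x, 2 <= x -> u x = (P x + Q x + W x)%C) ->
  0 <= K -> 0 <= KP -> 0 <= KQ -> 0 <= eta -> p + eta <= q -> q + eta <= r ->
  (forall x, 2 <= x -> Cmod (P x) <= KP * exp (- x * p)) ->
  (forall x, 2 <= x -> Cmod (Q x) <= KQ * exp (- x * q)) ->
  (forall x, 2 <= x -> Cmod (W x) <= K * exp (- x * r)) ->
  forall j, exists K', 0 <= K' /\ forall x, 2 <= x ->
    Cmod (u x ^ S j - (P x ^ S j + INR (S j) * P x ^ j * Q x))%C
      <= K' * exp (- x * (INR j * p + q + eta)).
Proof.
  intros Hu K0 KP0 KQ0 He Hpq Hqr HP HQ HW.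
  assert (X : forall x c d, 2 <= x -> d <= c -> exp (- x * c) <= exp (- x * d))
    by (intros; apply exp_le_compat; nra).
  induction j as [|j (K' & K'0 & IH)].
  - exists K. split; trivial. intros x Hx. rewrite Hu by trivial.
    replace (_ - _)%C with (W x) by (simpl; ring).
    eapply Rle_trans; [now apply HW|]. apply Rmult_le_compat_l; trivial.
    apply X; trivial. simpl. lra.
  - exists (K * KP ^ S j + INR (S j) * KP ^ j * KQ * (KQ + K) + (KP + KQ + K) * K').
    assert (PJ : 0 <= KP ^ j) by now apply pow_le.
    assert (PS : 0 <= KP ^ S j) by now apply pow_le.
    assert (IJ : 0 <= INR (S j)) by apply pos_INR.
    split.
    { repeat apply Rplus_le_le_0_compat; repeat apply Rmult_le_pos; try lra; exact PJ. }
    intros x Hx. specialize (IH x Hx). specialize (HP x Hx). specialize (HQ x Hx). specialize (HW x Hx).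
    set (V := (u x ^ S j - (P x ^ S j + INR (S j) * P x ^ j * Q x))%C) in *.
    (* The new error is W times the main power, plus the first-order term times Q + W, plus u times
       the old error V; each part accounts for one summand of the constant. *)
    replace (u x ^ S (S j) - (P x ^ S (S j) + INR (S (S j)) * P x ^ S j * Q x))%C
      with (W x * P x ^ S j + INR (S j) * P x ^ j * Q x * (Q x + W x) + u x * V)%C.
    2:{ unfold V. rewrite !(Cpow_S (u x)), (S_INR (S j)), RtoC_plus.
        rewrite (Hu x Hx). rewrite !Cpow_S. ring. }
    set (E := exp (- x * (INR (S j) * p + q + eta))).
    assert (EP : forall k, Cmod (P x ^ k)%C <= KP ^ k * exp (- x * (INR k * p))).
    { intros k. rewrite Cmod_pow.
      replace (- x * (INR k * p)) with (INR k * (- x * p)) by ring.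
      rewrite exp_INR_mult, <- Rpow_mult_distr. apply pow_incr. split; [apply Cmod_ge_0|trivial]. }
    assert (EQR : Cmod (Q x + W x)%C <= (KQ + K) * exp (- x * q)).
    { eapply Rle_trans; [apply Cmod_triangle|].
      assert (K * exp (- x * r) <= K * exp (- x * q)) by (apply Rmult_le_compat_l; trivial; apply X; lra).
      lra. }
    assert (EU : Cmod (u x) <= (KP + KQ + K) * exp (- x * p)).
    { rewrite Hu by trivial. rewrite <- Cplus_assoc.
      eapply Rle_trans; [apply Cmod_triangle|].
      assert ((KQ + K) * exp (- x * q) <= (KQ + K) * exp (- x * p))
        by (apply Rmult_le_compat_l; [lra|]; apply X; lra).
      lra. }
    match goal with |- _ <= (?a + ?b + ?c) * _ =>
      replace ((a + b + c) * E) with (a * E + b * E + c * E) by ring end.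
    eapply Rle_trans; [apply Cmod_triangle|]. apply Rplus_le_compat;
      [eapply Rle_trans; [apply Cmod_triangle|]; apply Rplus_le_compat|].
    + rewrite Cmod_mult.
      apply Rle_trans with ((K * exp (- x * r)) * (KP ^ S j * exp (- x * (INR (S j) * p)))).
      * apply Rmult_le_compat; trivial; apply Cmod_ge_0.
      * replace (_ * _) with (K * KP ^ S j * (exp (- x * r) * exp (- x * (INR (S j) * p)))) by ring.
        rewrite <- exp_plus. apply Rmult_le_compat_l; [now apply Rmult_le_pos|].
        rewrite <- Rmult_plus_distr_l. apply X; trivial. lra.
    + rewrite !Cmod_mult, Cmod_R, (Rabs_pos_eq (INR (S j))) by trivial.
      apply Rle_trans with (INR (S j) * (KP ^ j * exp (- x * (INR j * p))) * (KQ * exp (- x * q))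
         * ((KQ + K) * exp (- x * q))).
      * apply Rmult_le_compat; trivial; try apply Cmod_ge_0.
        { repeat apply Rmult_le_pos; trivial; apply Cmod_ge_0. }
        apply Rmult_le_compat; trivial; try apply Cmod_ge_0.
        { repeat apply Rmult_le_pos; trivial; apply Cmod_ge_0. }
        apply Rmult_le_compat_l; trivial.
      * replace (_ * _) with (INR (S j) * KP ^ j * KQ * (KQ + K) *
          (exp (- x * (INR j * p)) * exp (- x * q) * exp (- x * q))) by ring.
        rewrite <- !exp_plus. apply Rmult_le_compat_l.
        { repeat apply Rmult_le_pos; lra. }
        rewrite <- !Rmult_plus_distr_l. apply X; trivial. rewrite S_INR. lra.
    + rewrite Cmod_mult.
      apply Rle_trans with (((KP + KQ + K) * exp (- x * p)) * (K' * exp (- x * (INR j * p + q + eta)))).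
      * apply Rmult_le_compat; trivial; apply Cmod_ge_0.
      * replace (_ * _) with ((KP + KQ + K) * K' * (exp (- x * p) * exp (- x * (INR j * p + q + eta)))) by ring.
        rewrite <- exp_plus, <- Rmult_plus_distr_l. apply Rmult_le_compat_l.
        { apply Rmult_le_pos; lra. }
        apply X; trivial. rewrite S_INR. lra.
Qed.

(** The predecessors undo the index shift: coefficient [pred m] belongs to m^{-s}. *)
Lemma lnS_pred_mul i j : (0 < i)%nat -> (0 < j)%nat ->
  lnS (pred (i * j)) = lnS (pred i) + lnS (pred j).
Proof.
  intros Hi Hj. unfold lnS. rewrite !Nat.succ_pred_pos by nia.
  rewrite mult_INR. apply ln_mult; now apply lt_0_INR.
Qed.

Lemma lnS_pred_pow i j : (0 < i)%nat -> lnS (pred (i ^ j)) = INR j * lnS (pred i).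
Proof.
  intros Hi. induction j as [|j IH]; [simpl; rewrite lnS_0; ring|].
  assert (i ^ j <> 0)%nat by (apply Nat.pow_nonzero; lia).
  rewrite Nat.pow_succ_r', lnS_pred_mul, IH, S_INR by lia. ring.
Qed.

(* delta (log(n+2) - log(n+1)) is a multiple of 2 pi that tends to 0. *)
Lemma npow_neg_all_one_zero delta :
  (forall n, npow_neg (S n) (0, delta) = 1%C) -> delta = 0.
Proof.
  intros H.
  assert (Hs : forall n, cos (delta * lnS n) = 1 /\ sin (delta * lnS n) = 0).
  { intros n. specialize (H n). unfold npow_neg, RtoC in H. cbn [Re Im fst snd] in H.
    fold (lnS n) in H. rewrite Ropp_0, Rmult_0_l, exp_0 in H. injection H as H1 H2.
    split; lra. }
  assert (Z : forall n, sin (delta * (lnS (S n) - lnS n)) = 0).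
  { intros n. rewrite Rmult_minus_distr_l, sin_minus.
    destruct (Hs n) as [-> ->], (Hs (S n)) as [-> ->]. ring. }
  (* With n > |delta| and l <= 1/(n+1), the angle delta l lies in (-1, 1), where the sine vanishes
     only at 0. *)
  destruct (INR_unbounded (Rabs delta)) as [n Hn].
  set (l := lnS (S n) - lnS n) in *. specialize (Z n). fold l in Z.
  assert (Hl : 0 < l) by (unfold l; pose proof (lnS_lt n (S n) ltac:(lia)); lra).
  assert (Hl' : l * INR (S n) <= 1).
  { assert (P : 0 < INR (S n)) by (apply lt_0_INR; lia).
    assert (E : INR (S (S n)) = INR (S n) + 1) by apply S_INR.
    pose proof (ln_le_pred (INR (S (S n)) / INR (S n))) as L.
    unfold Rdiv in L. rewrite ln_mult, ln_Rinv in L; try lra; [|apply Rinv_0_lt_compat; lra].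
    assert (L' : l <= INR (S (S n)) * / INR (S n) - 1).
    { unfold l, lnS. apply L. rewrite E. apply Rmult_lt_0_compat; [lra|]. now apply Rinv_0_lt_compat. }
    apply (Rmult_le_compat_r (INR (S n))) in L'; [|lra].
    replace ((INR (S (S n)) * / INR (S n) - 1) * INR (S n)) with 1 in L'
      by (rewrite E; field; lra). exact L'. }
  rewrite S_INR in Hl'.
  pose proof PI_RGT_0. pose proof PI2_1.
  destruct (Rtotal_order delta 0) as [h|[h|h]]; trivial; exfalso.
  - rewrite Rabs_left in Hn by trivial.
    assert (sin (delta * l) < 0); [|lra]. apply sin_lt_0_var; nra.
  - rewrite Rabs_pos_eq in Hn by lra.
    assert (0 < sin (delta * l)); [|lra]. apply sin_gt_0; nra.
Qed.

(** * The matrix of a composition operator *)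

Section Composition.
Context (phi : C -> C) (T : seqC -> seqC)
  (Hphi : forall s, in_halfplane (1/2) s -> in_halfplane (1/2) (phi s))
  (HT : is_bounded_composition_operator phi T).

Lemma inH_T a : inH a -> inH (T a).
Proof. apply HT. Qed.

Lemma inH_iter_T k a : inH a -> inH (Nat.iter k T a).
Proof. intros H. induction k; simpl; [trivial|now apply inH_T]. Qed.

Lemma T_unit_seq_value n s :
  in_halfplane (1/2) s -> dirichlet_has_value (T (unit_seq n)) s (npow_neg (S n) (phi s)).
Proof.
  intros Hs. apply HT; trivial; [apply inH_unit_seq|]. apply dirichlet_unit_seq.
Qed.

(** Linearity is not part of [is_bounded_composition_operator]; it is recovered from the values
    f(phi(x)), which are linear in f and determine the coefficients. *)
Lemma T_linear c a b i :
  inH a -> inH b -> T (fun n => c * a n + b n)%C i = (c * T a i + T b i)%C.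
Proof.
  intros Ha Hb.
  assert (Hab : inH (fun n => c * a n + b n)%C) by (apply (inH_plus (fun n => c * a n)%C); trivial; now apply inH_scal).
  apply (dirichlet_unique (T (fun n => c * a n + b n)%C) (fun i => c * T a i + T b i)%C).
  - now apply inH_T.
  - apply (inH_plus (fun n => c * T a n)%C); [apply inH_scal|]; now apply inH_T.
  - intros x Hx. apply in_halfplane_real in Hx.
    destruct (dirichlet_ex_value a _ Ha (Hphi _ Hx)) as [va Hva].
    destruct (dirichlet_ex_value b _ Hb (Hphi _ Hx)) as [vb Hvb].
    exists (c * va + vb)%C.
    assert (L : forall (p q : seqC) z vp vq, dirichlet_has_value p z vp ->
      dirichlet_has_value q z vq -> dirichlet_has_value (fun n => c * p n + q n)%C z (c * vp + vq)%C).
    { intros p q z vp vq Hp Hq.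
      apply (Cseries_ext (fun n => c * (p n * npow_neg (S n) z) + q n * npow_neg (S n) z)%C).
      - intros n. ring.
      - apply Cseries_plus; trivial. now apply Cseries_scal. }
    split.
    + apply HT; trivial. now apply L.
    + apply L; apply HT; trivial.
Qed.

(** Boundedness lets T act term by term: a partial sum misses [T a j] by coefficient j of T applied
    to the remainder [r N], whose norm tends to 0. *)
Lemma T_coef a j :
  inH a -> Cseries (fun m => a m * T (unit_seq m) j)%C (T a j).
Proof.
  intros Ha.
  set (r := fun N m => if Nat.leb m N then RtoC 0 else a m).
  assert (Hr : forall N, inH (r N)).
  { intros N. apply (inH_le _ a); trivial. intros n. unfold r.
    destruct (Nat.leb n N); [rewrite Cmod_0; apply Cmod_ge_0|lra]. }
  assert (E : forall N, (@sum_n C_AbelianGroup (fun m => Cmult (a m) (T (unit_seq m) j)) N : C)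
     = (T a j - T (r N) j)%C).
  { induction N as [|N IH].
    - rewrite sum_O.
      replace (T a) with (T (fun n => a 0%nat * unit_seq 0 n + r 0%nat n)%C).
      + rewrite T_linear; [ring|apply inH_unit_seq|trivial].
      + f_equal. extensionality n. unfold r. destruct (Nat.leb_spec n 0).
        * replace n with 0%nat by lia. rewrite unit_seq_same. ring.
        * rewrite unit_seq_other by lia. ring.
    - rewrite sum_Sn, IH. change (plus ?x ?y) with (x + y)%C.
      replace (T (r N)) with (T (fun n => a (S N) * unit_seq (S N) n + r (S N) n)%C).
      + rewrite T_linear; [ring|apply inH_unit_seq|trivial].
      + f_equal. extensionality n. unfold r.
        destruct (Nat.leb_spec n (S N)), (Nat.leb_spec n N); try lia.
        * rewrite unit_seq_other by lia. ring.
        * replace n with (S N) by lia. rewrite unit_seq_same. ring.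
        * rewrite unit_seq_other by lia. ring. }
  destruct HT as (_ & _ & M & HM).
  assert (L : is_lim_seq (fun N => Cmod (T (r N) j)) 0).
  { apply (is_lim_seq_le_le (fun _ => 0) _ (fun N => M * Hnorm (r N))).
    - intros N. split; [apply Cmod_ge_0|].
      eapply Rle_trans; [apply coef_le_Hnorm, inH_T, Hr|apply HM, Hr].
    - apply is_lim_seq_const.
    - replace 0 with (M * 0) by ring.
      apply (is_lim_seq_scal_l _ M 0). now apply Hnorm_tail_lim. }
  apply filterlim_locally. intros eps.
  apply is_lim_seq_spec in L. destruct (L eps) as [N0 HN0].
  exists N0. intros N HN. specialize (HN0 N HN).
  apply C_NormedModule_mixin_compat1. rewrite E.
  change (minus ?x ?y) with (x - y)%C.
  replace (T a j - T (r N) j - T a j)%C with (- T (r N) j)%C by ring.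
  rewrite Cmod_opp. rewrite Rminus_0_r in HN0.
  now rewrite Rabs_pos_eq in HN0 by apply Cmod_ge_0.
Qed.

Lemma T_unit_seq_bound : exists M, 0 <= M /\ forall n j, Cmod (T (unit_seq n) j) <= M.
Proof.
  destruct HT as (_ & _ & M & HM).
  assert (B : forall n j, Cmod (T (unit_seq n) j) <= M).
  { intros n j. eapply Rle_trans; [apply coef_le_Hnorm, inH_T, inH_unit_seq|].
    eapply Rle_trans; [apply HM, inH_unit_seq|]. rewrite Hnorm_unit_seq. lra. }
  exists M. split; trivial. eapply Rle_trans; [apply Cmod_ge_0|apply (B 0%nat 0%nat)].
Qed.

Lemma T_unit_seq_0 j : T (unit_seq 0) j = unit_seq 0 j.
Proof.
  apply dirichlet_unique; [apply inH_T| |]; try apply inH_unit_seq.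
  intros x Hx. exists 1%C. split.
  - rewrite <- (npow_neg_1 (phi x)). apply T_unit_seq_value.
    now apply in_halfplane_real.
  - rewrite <- (npow_neg_1 x). apply dirichlet_unit_seq.
Qed.

(** The image takes the nonzero value (n+1)^{-phi(2)} at 2, so some coefficient is nonzero. *)
Lemma T_unit_seq_leading_index n : exists k, leading_index (T (unit_seq n)) k.
Proof.
  destruct (first_nonzero (T (unit_seq n))) as [H|H]; [|exact H]. exfalso.
  pose proof (T_unit_seq_value n 2%R (in_halfplane_real 2 (Rle_refl 2))) as V.
  apply (npow_neg_nonzero n (phi 2%R)).
  apply (Cseries_unique _ _ _ V).
  replace (RtoC 0) with (T (unit_seq n) 0%nat * npow_neg 1 2%R)%C by (rewrite H; ring).
  apply (Cseries_single 0%nat (fun m => T (unit_seq n) m * npow_neg (S m) 2%R)%C).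
  intros m _. rewrite H. ring.
Qed.

(** Both sides are [lnS n * lnS m] times -Re phi(s). This links the images of different basis
    vectors. *)
Lemma ln_Cmod_T_unit_seq n m s :
  lnS m * ln (Cmod (npow_neg (S n) (phi s))) = lnS n * ln (Cmod (npow_neg (S m) (phi s))).
Proof. rewrite !Cmod_npow_neg, !ln_exp. ring. Qed.

(** Inserting the expansion of the logarithm into [ln_Cmod_T_unit_seq] leaves an affine function of
    x that is exponentially small, so its slope and its constant vanish. These are the two
    identities: one for the leading indices, one for the moduli of the leading coefficients. *)
Lemma leading_index_growth n m k l :
  leading_index (T (unit_seq n)) k -> leading_index (T (unit_seq m)) l ->
  lnS m * lnS k = lnS n * lnS l /\
  lnS m * ln (Cmod (T (unit_seq n) k)) = lnS n * ln (Cmod (T (unit_seq m) l)).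
Proof.
  intros Hk Hl.
  destruct T_unit_seq_bound as (M & M0 & HM).
  destruct (ln_dirichlet_leading _ M k (HM n) Hk) as (K1 & x1 & K10 & Hx1 & H1).
  destruct (ln_dirichlet_leading _ M l (HM m) Hl) as (K2 & x2 & K20 & Hx2 & H2).
  set (d1 := lnS (S k) - lnS k) in *. set (d2 := lnS (S l) - lnS l) in *.
  assert (P1 : 0 < d1) by (unfold d1; pose proof (lnS_lt k (S k) ltac:(lia)); lra).
  assert (P2 : 0 < d2) by (unfold d2; pose proof (lnS_lt l (S l) ltac:(lia)); lra).
  set (bk := ln (Cmod (T (unit_seq n) k))) in *.
  set (bl := ln (Cmod (T (unit_seq m) l))) in *.
  pose proof (lnS_nonneg n) as Ln. pose proof (lnS_nonneg m) as Lm.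
  destruct (affine_exp_small_zero (lnS m * lnS k - lnS n * lnS l) (lnS n * bl - lnS m * bk)
    (lnS m * K1 + lnS n * K2) (Rmin d1 d2) (Rmax x1 x2)) as [Ea Eb]; [| | |split; lra].
  - apply Rmin_case; trivial.
  - apply Rplus_le_le_0_compat; apply Rmult_le_pos; trivial.
  - intros x Hx.
    assert (Hx1' : x1 <= x) by (eapply Rle_trans; [apply Rmax_l|exact Hx]).
    assert (Hx2' : x2 <= x) by (eapply Rle_trans; [apply Rmax_r|exact Hx]).
    pose proof (in_halfplane_real x ltac:(lra)) as Hh.
    specialize (H1 x _ Hx1' (T_unit_seq_value n x Hh)).
    specialize (H2 x _ Hx2' (T_unit_seq_value m x Hh)).
    pose proof (ln_Cmod_T_unit_seq n m x) as E.
    assert (E1 : exp (- x * d1) <= exp (- x * Rmin d1 d2))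
      by (apply exp_le_compat; pose proof (Rmin_l d1 d2); nra).
    assert (E2 : exp (- x * d2) <= exp (- x * Rmin d1 d2))
      by (apply exp_le_compat; pose proof (Rmin_r d1 d2); nra).
    set (u := ln (Cmod (npow_neg (S n) (phi x)))) in *.
    set (v := ln (Cmod (npow_neg (S m) (phi x)))) in *.
    assert (H1' : Rabs (u - (bk - x * lnS k)) <= K1 * exp (- x * Rmin d1 d2)) by nra.
    assert (H2' : Rabs (v - (bl - x * lnS l)) <= K2 * exp (- x * Rmin d1 d2)) by nra.
    replace (_ + _) with (lnS m * (u - (bk - x * lnS k)) - lnS n * (v - (bl - x * lnS l)))
      by lra.
    unfold Rminus at 1. eapply Rle_trans; [apply Rabs_triang|].
    rewrite Rabs_Ropp, !Rabs_mult, (Rabs_pos_eq (lnS m)), (Rabs_pos_eq (lnS n)) by trivial.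
    nra.
Qed.

(* Only moduli are compared, so each line Im s = tau gives the real part of one
   rotation of the coefficients; letting tau vary recovers the complex identity. *)
Lemma constant_term_growth n m :
  T (unit_seq n) 0%nat <> 0%C -> T (unit_seq m) 0%nat <> 0%C ->
  forall i, (i = 1 \/ i = 2)%nat ->
  (lnS m * (T (unit_seq n) i / T (unit_seq n) 0%nat))%C =
  (lnS n * (T (unit_seq m) i / T (unit_seq m) 0%nat))%C.
Proof.
  intros Hn Hm.
  destruct T_unit_seq_bound as (M & M0 & HM).
  set (X := fun i => (lnS m * (T (unit_seq n) i / T (unit_seq n) 0%nat)
     - lnS n * (T (unit_seq m) i / T (unit_seq m) 0%nat))%C).
  assert (Key : forall tau i, (i = 1 \/ i = 2)%nat ->
     Re (X i * rotation (tau * lnS i))%C = 0).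
  { intros tau.
    destruct (ln_dirichlet_second_order _ M tau (HM n) Hn) as (K1 & x1 & K10 & Hx1 & H1).
    destruct (ln_dirichlet_second_order _ M tau (HM m) Hm) as (K2 & x2 & K20 & Hx2 & H2).
    set (bn := ln (Cmod (T (unit_seq n) 0%nat))) in *.
    set (bm := ln (Cmod (T (unit_seq m) 0%nat))) in *.
    pose proof (lnS_nonneg n) as Ln. pose proof (lnS_nonneg m) as Lm.
    set (r := fun i => rotation (tau * lnS i)).
    destruct (three_exp_small_zero (lnS m * bn - lnS n * bm)
       (Re (X 1%nat * r 1%nat)%C) (Re (X 2%nat * r 2%nat)%C) (lnS m * K1 + lnS n * K2)
       (lnS 1) (lnS 2) (lnS 3) (Rmax x1 x2)) as (_ & E1 & E2).
    - split; [apply lnS_pos|apply lnS_lt]; lia.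
    - apply lnS_lt; lia.
    - eapply Rle_trans; [|apply Rmax_l]. lra.
    - intros x Hx.
      assert (Hx1' : x1 <= x) by (eapply Rle_trans; [apply Rmax_l|exact Hx]).
      assert (Hx2' : x2 <= x) by (eapply Rle_trans; [apply Rmax_r|exact Hx]).
      assert (Hh : in_halfplane (1/2) (x, tau)) by (unfold in_halfplane; cbn; lra).
      specialize (H1 x _ Hx1' (T_unit_seq_value n _ Hh)).
      specialize (H2 x _ Hx2' (T_unit_seq_value m _ Hh)).
      pose proof (ln_Cmod_T_unit_seq n m (x, tau)) as E.
      rewrite (npow_neg_polar 1), (npow_neg_polar 2) in H1, H2.
      fold (r 1%nat) (r 2%nat) in H1, H2.
      set (u := ln (Cmod (npow_neg (S n) (phi (x, tau))))) in *.
      set (v := ln (Cmod (npow_neg (S m) (phi (x, tau))))) in *.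
      match type of H1 with Rabs ?q <= _ => set (p := q) in H1 end.
      match type of H2 with Rabs ?q' <= _ => set (q := q') in H2 end.
      (* In the weighted difference of the two errors the logarithms of the values cancel by E. *)
      replace (_ + _) with (- (lnS m * p - lnS n * q)).
      + rewrite Rabs_Ropp. unfold Rminus. eapply Rle_trans; [apply Rabs_triang|].
        rewrite Rabs_Ropp, !Rabs_mult, (Rabs_pos_eq (lnS m)), (Rabs_pos_eq (lnS n)) by trivial.
        nra.
      + unfold p, q, X.
        assert (Q : forall (e : R) (z y : C), Re (z * (e * y))%C = e * Re (z * y)%C)
          by (intros e [z1 z2] [y1 y2]; cbn; ring).
        rewrite !Q.
        assert (Q' : forall (c d : R) (z y w : C),
          Re ((c * z - d * y) * w)%C = c * Re (z * w)%C - d * Re (y * w)%C)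
          by (intros c d [z1 z2] [y1 y2] [w1 w2]; cbn; ring).
        rewrite !Q'. nra.
    - intros i [-> | ->]; assumption. }
  intros i Hi.
  assert (Z : X i = 0%C).
  { apply (Re_rotation_zero _ (lnS i)); [apply lnS_pos; lia|].
    intros tau. now apply Key. }
  unfold X in Z.
  match goal with |- ?p = ?q => replace p with (p - q + q)%C by ring end.
  rewrite Z. ring.
Qed.

(** A relation between coefficients i and j of all columns holds on the range of T by [T_coef].
    Recurrent vectors are limits of elements of the range and are dense, so by continuity the
    relation holds on all of H; on [unit_seq i] it says c = 0. *)
Lemma recurrent_no_row_relation c d i j :
  recurrent T -> i <> j ->
  (forall n, (c * T (unit_seq n) i + d * T (unit_seq n) j)%C = 0%C) -> c = 0%C.
Proof.
  intros Hrec Hij H.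
  assert (Hrow : forall a, inH a -> (c * T a i + d * T a j)%C = 0%C).
  { intros a Ha.
    pose proof (Cseries_plus _ _ _ _
      (Cseries_scal c _ _ (T_coef a i Ha))
      (Cseries_scal d _ _ (T_coef a j Ha))) as S.
    apply (Cseries_unique _ _ _ S).
    apply (Cseries_ext (fun _ => 0%C)).
    - intros n. replace (_ + _)%C with (a n * (c * T (unit_seq n) i + d * T (unit_seq n) j))%C by ring.
      rewrite H. ring.
    - apply (Cseries_single 0%nat (fun _ => 0%C)). trivial. }
  set (L := Cmod c + Cmod d).
  assert (Near : forall x y eps, inH x -> inH y -> (c * x i + d * x j)%C = 0%C ->
     Hnorm (seq_sub x y) <= eps -> Cmod (c * y i + d * y j)%C <= L * eps).
  { intros x y eps Hx Hy E0 Hd.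
    assert (Hs : inH (seq_sub x y)) by now apply inH_seq_sub.
    replace (c * y i + d * y j)%C with
      (- (c * seq_sub x y i + d * seq_sub x y j) + (c * x i + d * x j))%C
      by (unfold seq_sub; ring).
    rewrite E0, Cplus_0_r, Cmod_opp.
    eapply Rle_trans; [apply Cmod_triangle|]. rewrite !Cmod_mult.
    pose proof (coef_le_Hnorm _ i Hs). pose proof (coef_le_Hnorm _ j Hs).
    pose proof (Cmod_ge_0 c). pose proof (Cmod_ge_0 d).
    unfold L. nra. }
  assert (L0 : 0 <= L) by (unfold L; pose proof (Cmod_ge_0 c); pose proof (Cmod_ge_0 d); lra).
  assert (Small : forall z : C, (forall eps, 0 < eps -> Cmod z <= L * eps) -> z = 0%C).
  { intros z Hz. apply Cmod_eq_0. apply Rle_antisym; [|apply Cmod_ge_0].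
    apply le_epsilon. intros eps He.
    assert (He' : 0 < eps / (L + 1)) by (apply Rdiv_lt_0_compat; lra).
    specialize (Hz _ He').
    assert (L * (eps / (L + 1)) <= eps); [|lra].
    apply (Rmult_le_reg_r (L + 1)); [lra|].
    unfold Rdiv. rewrite !Rmult_assoc, Rinv_l by lra. nra. }
  assert (Hr : forall x, Rec T x -> (c * x i + d * x j)%C = 0%C).
  { intros x (Hx & w & [Hw Hw'] & Hl). apply Small. intros eps He.
    apply is_lim_seq_spec in Hl. destruct (Hl (mkposreal eps He)) as [N HN].
    specialize (HN N (Nat.le_refl N)). cbn [pos] in HN. rewrite Rminus_0_r in HN.
    (* A positive exponent is what places the iterate in the range of T. *)
    assert (W : (1 <= w N)%nat).
    { clear HN. induction N as [|N IH]; trivial. specialize (Hw' N). lia. }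
    destruct (w N) as [|k] eqn:Ek; [lia|].
    pose proof (inH_iter_T k x Hx) as Hk.
    apply (Near (T (Nat.iter k T x)) x eps); trivial.
    - now apply inH_T.
    - now apply Hrow.
    - change (T (Nat.iter k T x)) with (Nat.iter (S k) T x).
      apply Rlt_le, Rle_lt_trans with (2 := HN), Rle_abs. }
  assert (Hall : forall a, inH a -> (c * a i + d * a j)%C = 0%C).
  { intros a Ha. apply Small. intros eps He.
    destruct (Hrec a Ha eps He) as (x & Rx & Hx & Hd).
    apply (Near x a eps); trivial; [now apply Hr|lra]. }
  specialize (Hall _ (inH_unit_seq i)).
  rewrite unit_seq_same, unit_seq_other in Hall by congruence.
  rewrite <- Hall. ring.
Qed.

(** * Recurrence forces a vertical translation *)

(** A recurrent x near [unit_seq j] has x_j nonzero, and coefficient j of T^k x is b^k x_j. For k >=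
    1 the distance from |b|^k to 1 is at least that from |b| to 1, so a return to x is possible only
    if |b| = 1. *)
Lemma recurrent_diagonal_coef b j :
  recurrent T -> (forall a, inH a -> T a j = (b * a j)%C) -> Cmod b = 1.
Proof.
  intros Hrec Hb.
  destruct (Hrec _ (inH_unit_seq j) (/ 2) ltac:(lra)) as (x & (Hx & w & [Hw Hw'] & Hl) & _ & Hd).
  assert (Hs : inH (seq_sub x (unit_seq j))) by (apply inH_seq_sub; trivial; apply inH_unit_seq).
  assert (Hxj : x j <> 0%C).
  { intros E. pose proof (coef_le_Hnorm _ j Hs) as H. unfold seq_sub in H at 1.
    rewrite E, unit_seq_same in H.
    replace (0 - 1)%C with (- (1))%C in H by ring. rewrite Cmod_m1 in H. lra. }
  apply Cmod_gt_0 in Hxj.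
  assert (Hit : forall k, Nat.iter k T x j = (b ^ k * x j)%C).
  { induction k as [|k IH]; [simpl; ring|].
    change (Nat.iter (S k) T x) with (T (Nat.iter k T x)).
    rewrite Hb by now apply inH_iter_T. rewrite IH, Cpow_S. ring. }
  assert (W : forall n, (1 <= w n)%nat).
  { induction n as [|n IH]; trivial. specialize (Hw' n). lia. }
  assert (Gap : forall n, Rabs (Cmod b - 1) * Cmod (x j) <= Hnorm (seq_sub (Nat.iter (w n) T x) x)).
  { intros n.
    assert (Hn : inH (seq_sub (Nat.iter (w n) T x) x))
      by (apply inH_seq_sub; trivial; now apply inH_iter_T).
    eapply Rle_trans; [|exact (coef_le_Hnorm _ j Hn)].
    unfold seq_sub. rewrite Hit.
    replace (b ^ w n * x j - x j)%C with ((b ^ w n - 1) * x j)%C by ring.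
    rewrite Cmod_mult. apply Rmult_le_compat_r; [lra|].
    pose proof (Cmod_triangle (b ^ w n - 1) 1) as T1.
    pose proof (Cmod_triangle (1 - b ^ w n) (b ^ w n)) as T2.
    replace (b ^ w n - 1 + 1)%C with (b ^ w n)%C in T1 by ring.
    replace (1 - b ^ w n + b ^ w n)%C with (RtoC 1) in T2 by ring.
    replace (1 - b ^ w n)%C with (- (b ^ w n - 1))%C in T2 by ring.
    rewrite Cmod_opp in T2. rewrite Cmod_1, Cmod_pow in T1, T2.
    specialize (W n). destruct (w n) as [|k]; [lia|]. cbn [pow] in *.
    pose proof (Cmod_ge_0 b) as B0.
    unfold Rabs. destruct (Rcase_abs _) as [B1|B1].
    - assert (Cmod b ^ k <= 1).
      { rewrite <- (pow1 k). apply pow_incr. lra. }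
      nra.
    - assert (1 <= Cmod b ^ k) by (apply pow_R1_Rle; lra). nra. }
  assert (Z : Rabs (Cmod b - 1) * Cmod (x j) <= 0).
  { apply (is_lim_seq_le (fun _ => Rabs (Cmod b - 1) * Cmod (x j)) _
      (Finite (Rabs (Cmod b - 1) * Cmod (x j))) (Finite 0) Gap).
    - apply is_lim_seq_const.
    - exact Hl. }
  pose proof (Rabs_pos (Cmod b - 1)).
  assert (Rabs (Cmod b - 1) = 0) by nra.
  apply Rabs_eq_0 in H0. lra.
Qed.

Lemma T_unit_seq_diagonal n :
  (forall i, (i < n)%nat -> T (unit_seq n) i = 0%C) -> Cmod (T (unit_seq n) n) = 1 ->
  forall i, i <> n -> T (unit_seq n) i = 0%C.
Proof.
  intros H0 H1. set (b := T (unit_seq n) n) in *.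
  destruct (T_unit_seq_bound) as (M & M0 & HM).
  (* The image without its leading term; its first nonzero coefficient d, at an index k > n, is to
     be refuted. *)
  set (g := seq_sub (T (unit_seq n)) (fun m => b * unit_seq n m)%C).
  assert (Hg : forall i, i <> n -> g i = T (unit_seq n) i).
  { intros i Hi. unfold g, seq_sub. rewrite unit_seq_other by trivial. ring. }
  assert (Hgn : g n = 0%C) by (unfold g, seq_sub; rewrite unit_seq_same; fold b; ring).
  destruct (first_nonzero g) as [Hz|(k & Hk & Hk0)].
  { intros i Hi. rewrite <- Hg by trivial. apply Hz. }
  exfalso.
  assert (Hkn : (n < k)%nat).
  { destruct (Nat.lt_total k n) as [h|[->|h]]; trivial; exfalso; apply Hk.
    - rewrite Hg by lia. now apply H0.
    - exact Hgn. }
  assert (gB : forall i, Cmod (g i) <= M).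
  { intros i. destruct (Nat.eq_dec i n) as [->|Hi]; [now rewrite Hgn, Cmod_0|].
    rewrite Hg by trivial. apply HM. }
  set (d := g k) in *.
  destruct (dirichlet_leading_term g M k gB Hk0) as (K & K0 & HK). fold d in HK.
  (* The margin for [power_second_order]: the smaller of the gaps between consecutive decay
     rates. *)
  set (eta := Rmin (lnS k - lnS n) (lnS (S k) - lnS k)).
  assert (He : 0 < eta).
  { unfold eta. pose proof (lnS_lt n k Hkn). pose proof (lnS_lt k (S k) ltac:(lia)).
    apply Rmin_case; lra. }
  set (u := fun x : R => npow_neg (S n) (phi x)).
  set (P := fun x : R => (b * npow_neg (S n) x)%C).
  set (Q := fun x : R => (d * npow_neg (S k) x)%C).
  set (W := fun x : R => (u x - P x - Q x)%C).
  assert (Hh := in_halfplane_real).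
  assert (Pow : forall j, exists K', 0 <= K' /\ forall x, 2 <= x ->
    Cmod (u x ^ S j - (P x ^ S j + INR (S j) * P x ^ j * Q x))%C
      <= K' * exp (- x * (INR j * lnS n + lnS k + eta))).
  { apply (power_second_order P Q W u (lnS n) (lnS k) (lnS (S k)) eta K 1 (Cmod d)); try lra.
    - intros x _. unfold W. ring.
    - apply Cmod_ge_0.
    - unfold eta. pose proof (Rmin_l (lnS k - lnS n) (lnS (S k) - lnS k)). lra.
    - unfold eta. pose proof (Rmin_r (lnS k - lnS n) (lnS (S k) - lnS k)). lra.
    - intros x _. unfold P. rewrite Cmod_mult, Cmod_npow_neg, H1. apply Rle_refl.
    - intros x _. unfold Q. rewrite Cmod_mult, Cmod_npow_neg. apply Rle_refl.
    - intros x Hx. apply (HK x (u x - P x)%C); [exact Hx|].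
      apply (Cseries_ext (fun m => T (unit_seq n) m * npow_neg (S m) x
         - b * (unit_seq n m * npow_neg (S m) x))%C).
      + intros m. unfold g, seq_sub. ring.
      + apply Cseries_minus; [apply T_unit_seq_value, Hh, Hx|].
        apply Cseries_scal, dirichlet_unit_seq. }
  assert (Coef : forall j, INR (S j) * Cmod d <= M).
  { intros j. destruct (Pow j) as (K' & K'0 & HK').
    (* The (j+1)-th power of the image of [unit_seq n] is that of [unit_seq N]; its first two terms
       have the shifted indices N and m. *)
    set (N := pred (S n ^ S j)). set (m := pred (S n ^ j * S k)).
    assert (Z1 : (S n ^ S j <> 0)%nat) by (apply Nat.pow_nonzero; lia).
    assert (Z2 : (S n ^ j <> 0)%nat) by (apply Nat.pow_nonzero; lia).
    assert (SN : S N = (S n ^ S j)%nat) by (apply Nat.succ_pred_pos; lia).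
    assert (Sm : S m = (S n ^ j * S k)%nat) by (apply Nat.succ_pred_pos; nia).
    assert (Hm : m <> N).
    { intros E. assert (E' : S m = S N) by now rewrite E.
      rewrite SN, Sm, Nat.pow_succ_r' in E'. nia. }
    assert (Lm : lnS m = INR j * lnS n + lnS k).
    { unfold m. rewrite lnS_pred_mul, lnS_pred_pow by lia. reflexivity. }
    set (c := (INR (S j) * b ^ j * d)%C).
    (* Subtracting the two main terms leaves values that decay faster than (m+1)^{-x}, so
       coefficient m of the difference is zero; as m differs from N, c is coefficient m of the
       image. *)
    set (h := fun i => (T (unit_seq N) i - (b ^ S j * unit_seq N i + c * unit_seq m i))%C).
    assert (Hc : h m = 0%C).
    { apply (dirichlet_coef_vanish h (M + (1 + Cmod c)) m K' (INR j * lnS n + lnS k + eta)); trivial.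
      - intros i. unfold h, Cminus. eapply Rle_trans; [apply Cmod_triangle|].
        rewrite Cmod_opp. apply Rplus_le_compat; [apply HM|].
        eapply Rle_trans; [apply Cmod_triangle|].
        rewrite !Cmod_mult, Cmod_pow, H1, pow1.
        assert (U : forall p q, Cmod (unit_seq p q) <= 1).
        { intros p q. unfold unit_seq. destruct (Nat.eqb q p); [rewrite Cmod_1|rewrite Cmod_0]; lra. }
        pose proof (U N i). pose proof (U m i). pose proof (Cmod_ge_0 c). nra.
      - lra.
      - intros x Hx. exists (u x ^ S j - (P x ^ S j + INR (S j) * P x ^ j * Q x))%C.
        split; [|now apply HK'].
        replace (P x ^ S j + INR (S j) * P x ^ j * Q x)%C
          with (b ^ S j * npow_neg (S N) x + c * npow_neg (S m) x)%C.
        + apply (Cseries_ext (fun i => T (unit_seq N) i * npow_neg (S i) x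
            - (b ^ S j * (unit_seq N i * npow_neg (S i) x) + c * (unit_seq m i * npow_neg (S i) x)))%C).
          * intros i. unfold h. ring.
          * apply Cseries_minus.
            -- unfold u. rewrite <- npow_neg_pow, <- SN by lia.
               apply T_unit_seq_value, Hh, Hx.
            -- apply Cseries_plus; apply Cseries_scal, dirichlet_unit_seq.
        + rewrite SN, Sm, npow_neg_mul, !npow_neg_pow by lia.
          unfold P, Q, c. rewrite !Cpow_mult_l. ring. }
    unfold h in Hc. rewrite unit_seq_same, unit_seq_other in Hc by trivial.
    assert (Ec : T (unit_seq N) m = c).
    { replace (T (unit_seq N) m) with
        (T (unit_seq N) m - (b ^ S j * 0 + c * 1) + c)%C by ring.
      rewrite Hc. ring. }
    specialize (HM N m). rewrite Ec in HM. unfold c in HM.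
    rewrite !Cmod_mult, Cmod_pow, H1, pow1, Cmod_R, Rabs_pos_eq in HM by apply pos_INR.
    lra. }
  apply Cmod_gt_0 in Hk. fold d in Hk.
  destruct (INR_archimed (Cmod d) M Hk) as [j Hj].
  specialize (Coef j). rewrite S_INR in Coef. nra.
Qed.

Lemma recurrent_leading_index_1 k :
  recurrent T -> leading_index (T (unit_seq 1)) k -> k = 1%nat.
Proof.
  intros Hrec Hk.
  pose proof (lnS_lt 0 1 ltac:(lia)) as l1. rewrite lnS_0 in l1.
  destruct k as [|[|k]]; trivial; exfalso.
  - assert (H0 : forall n, T (unit_seq n) 0%nat <> 0%C).
    { intros n. destruct (T_unit_seq_leading_index n) as [l Hl].
      destruct (leading_index_growth n 1 l 0 Hl Hk) as [E _].
      rewrite lnS_0, Rmult_0_r in E. apply Rmult_integral in E. destruct E as [E|E]; [lra|].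
      rewrite <- lnS_0 in E. apply lnS_inj in E. subst l. apply Hl. }
    (* Rows 1 and 2 of the matrix are A and B times one common row, so B row_1 - A row_2 = 0. This
       forces A = B = 0, hence row 1 is zero, which is excluded as well. *)
    set (A := (T (unit_seq 1) 1%nat / T (unit_seq 1) 0%nat)%C).
    set (B := (T (unit_seq 1) 2%nat / T (unit_seq 1) 0%nat)%C).
    assert (Row : forall n i, (i = 1 \/ i = 2)%nat ->
       T (unit_seq n) i = (T (unit_seq n) 0%nat * (lnS n / lnS 1)%R
         * (T (unit_seq 1) i / T (unit_seq 1) 0%nat))%C).
    { intros n i Hi.
      pose proof (constant_term_growth n 1 (H0 n) (H0 1%nat) i Hi) as E.
      assert (L : RtoC (lnS 1) <> 0%C) by (intros E'; injection E'; lra).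
      rewrite RtoC_div by lra.
      replace (T (unit_seq n) 0%nat * (lnS n / lnS 1) * (T (unit_seq 1) i / T (unit_seq 1) 0%nat))%C
        with (T (unit_seq n) 0%nat / lnS 1 * (lnS n * (T (unit_seq 1) i / T (unit_seq 1) 0%nat)))%C
        by (field; repeat split; trivial; apply H0).
      rewrite <- E. field; repeat split; trivial; apply H0. }
    assert (B0 : B = 0%C).
    { apply (recurrent_no_row_relation B (- A)%C 1 2 Hrec ltac:(lia)).
      intros n. rewrite (Row n 1%nat), (Row n 2%nat) by tauto. fold A B. ring. }
    assert (A0 : (- A)%C = 0%C).
    { apply (recurrent_no_row_relation (- A)%C B 2 1 Hrec ltac:(lia)).
      intros n. rewrite (Row n 1%nat), (Row n 2%nat) by tauto. fold A B. ring. }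
    assert (One : RtoC 1 = 0%C); [|injection One; lra].
    apply (recurrent_no_row_relation 1%C 0%C 1 2 Hrec ltac:(lia)).
    intros n. rewrite (Row n 1%nat) by tauto. fold A.
    replace A with (- (- A))%C by ring. rewrite A0. ring.
  (* A leading index above 1 for [unit_seq 1] pushes the leading index of every [unit_seq n] with n
     >= 1 above 1, so row 1 is zero. *)
  - assert (One : RtoC 1 = 0%C); [|injection One; lra].
    apply (recurrent_no_row_relation 1%C 0%C 1 2 Hrec ltac:(lia)).
    intros n. cut (T (unit_seq n) 1%nat = 0%C); [intros ->; ring|].
    destruct n as [|n]; [now rewrite T_unit_seq_0, unit_seq_other by lia|].
    destruct (T_unit_seq_leading_index (S n)) as [l Hl].
    destruct (leading_index_growth (S n) 1 l _ Hl Hk) as [E _].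
    apply Hl. destruct (Nat.lt_ge_cases 1 l) as [h|h]; trivial. exfalso.
    pose proof (lnS_lt 1 (S (S k)) ltac:(lia)) as L2.
    pose proof (lnS_le 1 (S n) ltac:(lia)) as L3.
    pose proof (lnS_le l 1 h) as L4. nra.
Qed.

(** Every image of [unit_seq m] starts at m and [unit_seq 0] is fixed, so row 1 has only its
    diagonal entry. Recurrence makes that entry unimodular, and the second identity of
    [leading_index_growth] carries this to all n. *)
Lemma recurrent_T_unit_seq n :
  recurrent T -> exists b, Cmod b = 1 /\ forall i, T (unit_seq n) i = (b * unit_seq n i)%C.
Proof.
  intros Hrec.
  destruct n as [|n].
  { exists 1%C. split; [apply Cmod_1|]. intros i. rewrite T_unit_seq_0. ring. }
  assert (l1 : 0 < lnS 1) by (apply lnS_pos; lia).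
  destruct (T_unit_seq_leading_index 1) as [k1 Hk1].
  assert (k1 = 1%nat) by now apply recurrent_leading_index_1. subst k1.
  assert (Lead : forall m, leading_index (T (unit_seq m)) m).
  { intros m. destruct (T_unit_seq_leading_index m) as [k Hk].
    destruct (leading_index_growth m 1 k 1 Hk Hk1) as [E _].
    assert (E' : lnS k = lnS m) by nra. apply lnS_inj in E'. now subst k. }
  assert (B1 : Cmod (T (unit_seq 1) 1%nat) = 1).
  { apply (recurrent_diagonal_coef _ 1 Hrec).
    intros a Ha. apply (Cseries_unique _ _ _ (T_coef a 1 Ha)).
    replace (T (unit_seq 1) 1%nat * a 1%nat)%C with (a 1%nat * T (unit_seq 1) 1%nat)%C by ring.
    apply (Cseries_single 1%nat (fun m => a m * T (unit_seq m) 1%nat)%C).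
    intros m Hm. destruct m as [|m].
    - rewrite T_unit_seq_0, unit_seq_other by lia. ring.
    - destruct (Lead (S m)) as [_ Z]. rewrite Z by lia. ring. }
  set (b := T (unit_seq (S n)) (S n)).
  assert (Bn : Cmod b = 1).
  { destruct (leading_index_growth (S n) 1 (S n) 1 (Lead (S n)) Hk1) as [_ E].
    fold b in E. rewrite B1, ln_1, Rmult_0_r in E.
    apply Rmult_integral in E. destruct E as [E|E]; [lra|].
    apply ln_inv; [apply Cmod_gt_0, Lead|lra|]. now rewrite ln_1. }
  exists b. split; trivial. intros i.
  destruct (Nat.eq_dec i (S n)) as [->|Hi].
  - rewrite unit_seq_same. fold b. ring.
  - rewrite unit_seq_other by trivial.
    rewrite (T_unit_seq_diagonal (S n) (proj2 (Lead (S n))) Bn i Hi). ring.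
Qed.

(** Evaluating the diagonal action shows that (n+1)^{-(phi(s) - s)} is a unimodular constant in s
    for every n. Its modulus gives Re(phi(s) - s) = 0. Comparison with the reference point s0 = 2
    leaves an imaginary difference i delta with all (n+1)^{-i delta} equal to 1. *)
Lemma recurrent_translation :
  recurrent T -> exists t, forall s, in_halfplane (1/2) s -> phi s = (s + (0, t))%C.
Proof.
  intros Hrec.
  set (s0 := RtoC 2).
  assert (H0 : in_halfplane (1/2) s0) by (apply in_halfplane_real; lra).
  assert (Key : forall n, exists b, Cmod b = 1 /\ forall s, in_halfplane (1/2) s ->
     npow_neg (S n) (phi s - s)%C = b).
  { intros n. destruct (recurrent_T_unit_seq n Hrec) as (b & Hb & Hn).
    exists b. split; trivial. intros s Hs.
    assert (E : npow_neg (S n) (phi s) = (b * npow_neg (S n) s)%C).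
    { apply (Cseries_unique _ _ _ (T_unit_seq_value n s Hs)).
      apply (Cseries_ext (fun i => b * (unit_seq n i * npow_neg (S i) s))%C).
      - intros i. rewrite Hn. ring.
      - apply Cseries_scal, dirichlet_unit_seq. }
    replace (phi s) with ((phi s - s) + s)%C in E by ring.
    rewrite npow_neg_plus in E.
    pose proof (npow_neg_nonzero n s) as Z.
    replace (npow_neg (S n) (phi s - s)%C)
      with (npow_neg (S n) (phi s - s)%C * npow_neg (S n) s / npow_neg (S n) s)%C by (field; trivial).
    rewrite E. field. trivial. }
  assert (ReZ : forall s, in_halfplane (1/2) s -> Re (phi s - s)%C = 0).
  { intros s Hs. destruct (Key 1%nat) as (b & Hb & Hn). specialize (Hn s Hs).
    rewrite <- Hn, Cmod_npow_neg, <- exp_0 in Hb. apply exp_inv in Hb.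
    pose proof (lnS_pos 1 ltac:(lia)). nra. }
  exists (Im (phi s0 - s0)%C). intros s Hs.
  assert (D : (phi s - s - (phi s0 - s0))%C = (0, Im (phi s - s - (phi s0 - s0))%C)).
  { rewrite (surjective_pairing (phi s - s - (phi s0 - s0))%C) at 1. f_equal.
    change (Re (phi s - s - (phi s0 - s0))%C = 0).
    pose proof (ReZ s Hs). pose proof (ReZ s0 H0).
    unfold Cminus at 1. rewrite re_plus, re_opp. lra. }
  set (delta := Im (phi s - s - (phi s0 - s0))%C) in D.
  assert (Z : delta = 0).
  { apply npow_neg_all_one_zero. intros n. rewrite <- D.
    destruct (Key n) as (b & Hb & Hn).
    pose proof (Hn s Hs) as E1. pose proof (Hn s0 H0) as E2.
    replace (phi s - s)%C with ((phi s - s - (phi s0 - s0)) + (phi s0 - s0))%C in E1 by ring.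
    rewrite npow_neg_plus, E2 in E1.
    assert (b0 : b <> 0%C) by (apply Cmod_gt_0; lra).
    match goal with |- ?z = _ => replace z with (z * b / b)%C by (field; trivial) end.
    rewrite E1. field. trivial. }
  rewrite Z in D.
  replace (phi s) with (s + (phi s0 - s0) + (phi s - s - (phi s0 - s0)))%C by ring.
  rewrite D. change (0, 0) with (RtoC 0). rewrite Cplus_0_r. f_equal.
  rewrite (surjective_pairing (phi s0 - s0)%C) at 1. f_equal. exact (ReZ s0 H0).
Qed.

End Composition.

(** * Vertical translations *)

Lemma pigeonhole n (f : nat -> nat) :
  (forall i, (i <= n)%nat -> (f i < n)%nat) ->
  exists i j, (i < j <= n)%nat /\ f i = f j.
Proof.
  intros Hf. apply NNPP. intros N.
  assert (Hinj : forall i j, (i < j <= n)%nat -> f i <> f j)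
    by (intros i j Hij E; apply N; now exists i, j).
  assert (ND : NoDup (map f (seq 0 (S n)))).
  { apply Injective_map_NoDup_in; [|apply seq_NoDup].
    intros i j Hi Hj E. apply in_seq in Hi, Hj.
    destruct (Nat.lt_total i j) as [h|[h|h]]; trivial; exfalso.
    - apply (Hinj i j); [lia|trivial].
    - apply (Hinj j i); [lia|now symmetry]. }
  apply (NoDup_incl_length (l' := seq 0 n)) in ND.
  - rewrite length_map, !length_seq in ND. lia.
  - intros y Hy. apply in_map_iff in Hy. destruct Hy as (i & <- & Hi).
    apply in_seq in Hi. apply in_seq. specialize (Hf i ltac:(lia)). lia.
Qed.

(* Pigeonhole on a (2m+1) x (2m+1) grid of boxes for the real and imaginary
   parts of the powers of z. *)
Lemma unimodular_return eps :
  0 < eps -> exists M, forall z, Cmod z = 1 ->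
    exists q, (1 <= q <= M)%nat /\ Cmod (z ^ q - 1)%C < eps.
Proof.
  intros He.
  (* Boxes have side 1/m, so two points of one box are at most 2/m < eps apart. Coordinates in
     [-1, 1] scale to [0, 2m], hence 2m + 1 boxes per axis. *)
  destruct (INR_unbounded (2 / eps)) as [m Hm].
  assert (He' : 0 < 2 / eps) by (apply Rdiv_lt_0_compat; lra).
  assert (Hm2 : 2 / INR m < eps).
  { apply (Rmult_lt_reg_r (INR m)); [lra|]. unfold Rdiv. rewrite Rmult_assoc, Rinv_l by lra.
    apply (Rmult_lt_compat_r eps) in Hm; [|lra].
    unfold Rdiv in Hm. rewrite Rmult_assoc, Rinv_l in Hm; lra. }
  set (L := (2 * m + 1)%nat).
  exists (L * L)%nat. intros z Hz.
  assert (Hpos : forall x, -1 <= x -> 0 <= (x + 1) * INR m) by (intros; nra).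
  assert (Hre : forall i, -1 <= Re (z ^ i)%C <= 1).
  { intros i. pose proof (re_le_Cmod (z ^ i)) as H. rewrite Cmod_pow, Hz, pow1 in H.
    now apply Rabs_le_between in H. }
  assert (Him : forall i, -1 <= Im (z ^ i)%C <= 1).
  { intros i. pose proof (Rmax_Cmod (z ^ i)%C) as H. rewrite Cmod_pow, Hz, pow1 in H.
    apply Rabs_le_between. eapply Rle_trans; [apply Rmax_r|exact H]. }
  set (fl := fun x (H : -1 <= x) => proj1_sig (nfloor_ex _ (Hpos x H))).
  assert (Hfl : forall x (H : -1 <= x), INR (fl x H) <= (x + 1) * INR m < INR (fl x H) + 1).
  { intros x H. unfold fl. now destruct (nfloor_ex _ _). }
  assert (Hlt : forall x (H : -1 <= x), x <= 1 -> (fl x H < L)%nat).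
  { intros x H H1. apply INR_lt. destruct (Hfl x H) as [F _]. unfold L.
    rewrite plus_INR, mult_INR. cbn [INR]. nra. }
  destruct (pigeonhole (L * L) (fun i => fl _ (proj1 (Hre i)) * L + fl _ (proj1 (Him i)))%nat)
    as (i & j & Hij & E).
  { intros i _. pose proof (Hlt _ (proj1 (Hre i)) (proj2 (Hre i))).
    pose proof (Hlt _ (proj1 (Him i)) (proj2 (Him i))). nia. }
  exists (j - i)%nat. split; [lia|].
  assert (E1 : fl _ (proj1 (Hre i)) = fl _ (proj1 (Hre j)) /\ fl _ (proj1 (Him i)) = fl _ (proj1 (Him j))).
  { pose proof (Hlt _ (proj1 (Him i)) (proj2 (Him i))).
    pose proof (Hlt _ (proj1 (Him j)) (proj2 (Him j))). cbv beta in E.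
    apply (Nat.div_mod_unique L); lia. }
  destruct E1 as [E1 E2].
  pose proof (Hfl _ (proj1 (Hre i))) as F1. pose proof (Hfl _ (proj1 (Hre j))) as F2.
  pose proof (Hfl _ (proj1 (Him i))) as F3. pose proof (Hfl _ (proj1 (Him j))) as F4.
  rewrite <- E1 in F2. rewrite <- E2 in F4.
  set (d := (z ^ j - z ^ i)%C).
  assert (Ed : Cmod (z ^ (j - i) - 1)%C = Cmod d).
  { unfold d. replace (z ^ j)%C with (z ^ i * z ^ (j - i))%C
      by (rewrite <- Cpow_add_r; f_equal; lia).
    replace (z ^ i * z ^ (j - i) - z ^ i)%C with (z ^ i * (z ^ (j - i) - 1))%C by ring.
    rewrite Cmod_mult, Cmod_pow, Hz, pow1. ring. }
  rewrite Ed.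
  assert (Dre : Re d = Re (z ^ j)%C - Re (z ^ i)%C) by (unfold d, Cminus; rewrite re_plus, re_opp; ring).
  assert (Dim : Im d = Im (z ^ j)%C - Im (z ^ i)%C) by (unfold d, Cminus; rewrite im_plus, im_opp; ring).
  assert (Bre : Rabs (Re d) * INR m <= 1).
  { rewrite Dre. unfold Rabs. destruct (Rcase_abs _); lra. }
  assert (Bim : Rabs (Im d) * INR m <= 1).
  { rewrite Dim. unfold Rabs. destruct (Rcase_abs _); lra. }
  apply Rle_lt_trans with (2 := Hm2).
  apply (Rmult_le_reg_r (INR m)); [lra|].
  unfold Rdiv. rewrite Rmult_assoc, Rinv_l, Rmult_1_r by lra.
  assert (Tri : Cmod d <= Rabs (Re d) + Rabs (Im d)).
  { pose proof (Cmod2_alt d) as S. pose proof (Cmod_ge_0 d).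
    rewrite <- (pow2_abs (Re d)), <- (pow2_abs (Im d)) in S.
    pose proof (Rabs_pos (Re d)). pose proof (Rabs_pos (Im d)). nra. }
  nra.
Qed.

Lemma Cmod_pow_minus_1_le z q : Cmod z = 1 -> Cmod (z ^ q - 1)%C <= INR q * Cmod (z - 1)%C.
Proof.
  intros Hz. induction q as [|q IH].
  - simpl. replace (1 - 1)%C with (RtoC 0) by ring. rewrite Cmod_0. lra.
  - rewrite S_INR, Cpow_S.
    replace (z * z ^ q - 1)%C with (z * (z ^ q - 1) + (z - 1))%C by ring.
    eapply Rle_trans; [apply Cmod_triangle|]. rewrite Cmod_mult, Hz. lra.
Qed.

Lemma unimodular_simultaneous_return (z : nat -> C) :
  (forall j, Cmod (z j) = 1) -> forall N eps, 0 < eps ->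
  exists k, (1 <= k)%nat /\ forall j, (j < N)%nat -> Cmod (z j ^ k - 1)%C < eps.
Proof.
  intros Hz. induction N as [|N IH]; intros eps He.
  - exists 1%nat. split; [lia|]. intros j Hj. lia.
  (* A common return time k of the first N numbers is chosen so precise that its
     first M multiples still work; one of them is a return time of z N. *)
  - destruct (unimodular_return eps He) as [M HM].
    assert (P : 0 < INR M + 1) by (pose proof (pos_INR M); lra).
    destruct (IH (eps / (INR M + 1))) as (k & Hk & Hkj); [now apply Rdiv_lt_0_compat|].
    destruct (HM (z N ^ k)%C) as (q & Hq & HqN); [now rewrite Cmod_pow, Hz, pow1|].
    exists (k * q)%nat. split; [nia|]. intros j Hj. rewrite Cpow_mult_r.
    destruct (Nat.eq_dec j N) as [->|Hne]; trivial.
    eapply Rle_lt_trans; [apply Cmod_pow_minus_1_le; now rewrite Cmod_pow, Hz, pow1|].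
    specialize (Hkj j ltac:(lia)).
    assert (Q : INR q <= INR M) by (apply le_INR; lia).
    pose proof (pos_INR q). pose proof (Cmod_ge_0 (z j ^ k - 1)).
    apply Rle_lt_trans with (INR M * Cmod (z j ^ k - 1)%C); [now apply Rmult_le_compat_r|].
    assert (E : eps = (INR M + 1) * (eps / (INR M + 1))) by (field; lra).
    assert (D : 0 < eps / (INR M + 1)) by now apply Rdiv_lt_0_compat.
    rewrite E. nra.
Qed.

(** A diagonal choice: for n >= 1, [w n] brings the first n numbers within 1/(n+1) of 1, and each
    search starts above the previous exponent. *)
Lemma unimodular_recurrence (z : nat -> C) :
  (forall j, Cmod (z j) = 1) ->
  exists w, pos_strict_incr w /\
    forall j, is_lim_seq (fun n => Cmod (z j ^ w n - 1)%C) 0.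
Proof.
  intros Hz.
  assert (Ex : forall n K, exists k, (K <= k /\ 1 <= k)%nat /\
     forall j, (j < n)%nat -> Cmod (z j ^ k - 1)%C < / INR (S n)).
  { intros n K.
    assert (P : 0 < INR (S K)) by (apply lt_0_INR; lia).
    assert (P' : 0 < / INR (S n)) by (apply Rinv_0_lt_compat, lt_0_INR; lia).
    destruct (unimodular_simultaneous_return z Hz n (/ INR (S n) / INR (S K))) as (k & Hk & Hkj);
      [now apply Rdiv_lt_0_compat|].
    (* The multiple exceeds K, and the precision of k was taken K + 1 times finer to pay for it. *)
    exists (k * S K)%nat. split; [nia|]. intros j Hj. rewrite Cpow_mult_r.
    eapply Rle_lt_trans; [apply Cmod_pow_minus_1_le; now rewrite Cmod_pow, Hz, pow1|].
    specialize (Hkj j Hj).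
    apply (Rmult_lt_compat_l (INR (S K))) in Hkj; trivial.
    replace (INR (S K) * (/ INR (S n) / INR (S K))) with (/ INR (S n)) in Hkj; trivial.
    field. split; apply not_0_INR; lia. }
  set (g := fun n K => proj1_sig (constructive_indefinite_description _ (Ex n K))).
  assert (Hg : forall n K, (K <= g n K /\ 1 <= g n K)%nat /\
     forall j, (j < n)%nat -> Cmod (z j ^ g n K - 1)%C < / INR (S n)).
  { intros n K. unfold g. now destruct (constructive_indefinite_description _ _). }
  set (w := fix w n := match n with O => g 0%nat 1%nat | S m => g (S m) (S (w m)) end).
  exists w. split; [split|].
  - apply Hg.
  - intros n. change (w (S n)) with (g (S n) (S (w n))). destruct (Hg (S n) (S (w n))). lia.
  - intros j.
    apply (is_lim_seq_le_le_loc (fun _ => 0) _ (fun n => / INR (S n))).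
    + exists (S j). intros n Hn. split; [apply Cmod_ge_0|]. apply Rlt_le.
      destruct n as [|n]; [lia|]. change (w (S n)) with (g (S n) (S (w n))).
      apply Hg. lia.
    + apply is_lim_seq_const.
    + apply is_lim_seq_spec. intros eps. destruct (INR_unbounded (/ eps)) as [N HN].
      pose proof (cond_pos eps) as Pe.
      assert (Pi : 0 < / eps) by now apply Rinv_0_lt_compat.
      exists N. intros n Hn. rewrite Rminus_0_r.
      assert (INR N < INR (S n)) by (apply lt_INR; lia).
      rewrite Rabs_pos_eq by (apply Rlt_le, Rinv_0_lt_compat; lra).
      rewrite <- (Rinv_inv eps). apply Rinv_lt_contravar; [nra|lra].
Qed.

(** Dominated convergence: the tail is at most 4 times the tail of |a_j|^2, uniformly in n, and the
    finite head tends to 0. *)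
Lemma Hnorm_multiplier_lim (u : nat -> nat -> C) a :
  inH a -> (forall n j, Cmod (u n j) <= 2) ->
  (forall j, is_lim_seq (fun n => Cmod (u n j)) 0) ->
  is_lim_seq (fun n => Hnorm (fun j => u n j * a j)%C) 0.
Proof.
  intros Ha Hb Hu.
  set (v := fun j => Cmod (a j) ^ 2).
  set (d := fun n j => Cmod (u n j * a j)%C ^ 2).
  assert (Hd : forall n, ex_series (d n)).
  { intros n. apply (inH_le _ (fun j => 2 * a j)%C).
    - intros j. rewrite !Cmod_mult, Cmod_R, Rabs_pos_eq by lra.
      apply Rmult_le_compat_r; [apply Cmod_ge_0|apply Hb].
    - now apply inH_scal. }
  assert (Hdv : forall n j, 0 <= d n j <= 4 * v j).
  { intros n j. split; [apply pow2_ge_0|]. unfold d, v. rewrite Cmod_mult, Rpow_mult_distr.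
    apply Rmult_le_compat_r; [apply pow2_ge_0|].
    replace 4 with (2 ^ 2) by ring. apply pow_incr. split; [apply Cmod_ge_0|apply Hb]. }
  assert (L : is_lim_seq (fun n => Series (d n)) 0).
  { apply is_lim_seq_spec. intros eps. pose proof (cond_pos eps) as Pe.
    pose proof (Series_correct v Ha) as Sv.
    assert (Lv : is_lim_seq (sum_n v) (Series v)) by exact Sv.
    apply is_lim_seq_spec in Lv.
    (* With the factor 4 the tail costs at most eps/2; the head gets the other half. *)
    destruct (Lv (mkposreal (eps / 8) ltac:(lra))) as [N HN].
    specialize (HN N (Nat.le_refl N)). cbn [pos] in HN. apply Rabs_lt_between in HN.
    assert (Head : is_lim_seq (fun n => sum_f_R0 (d n) N) 0).
    { clear HN. assert (Hj : forall j, is_lim_seq (fun n => d n j) 0).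
      { intros j. unfold d.
        apply (is_lim_seq_ext (fun n => (Cmod (u n j) * Cmod (u n j)) * Cmod (a j) ^ 2)).
        - intros n. rewrite Cmod_mult. ring.
        - replace 0 with (0 * 0 * Cmod (a j) ^ 2) by ring.
          apply is_lim_seq_mult'; [apply is_lim_seq_mult'; apply Hu|apply is_lim_seq_const]. }
      induction N as [|N IH]; [apply Hj|].
      replace 0 with (0 + 0) by ring. simpl. now apply is_lim_seq_plus'. }
    apply is_lim_seq_spec in Head.
    destruct (Head (mkposreal (eps / 2) ltac:(lra))) as [n0 Hn0]. cbn [pos] in Hn0.
    exists n0. intros n Hn. specialize (Hn0 n Hn). rewrite Rminus_0_r in *.
    apply Rabs_lt_between in Hn0.
    rewrite (Series_incr_n (d n) (S N)) by (lia || apply Hd). cbn [Init.Nat.pred].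
    rewrite (Series_incr_n v (S N)), sum_n_Reals in HN by (lia || exact Ha). cbn [Init.Nat.pred] in HN.
    assert (T1 : Series (fun k => d n (S N + k)%nat) <= Series (fun k => 4 * v (S N + k)%nat)).
    { apply Series_le; [intros k; apply Hdv|].
      apply (ex_series_scal (V := R_NormedModule) 4).
      now apply (ex_series_incr_n (V := R_NormedModule) v (S N)). }
    rewrite Series_scal_l in T1.
    assert (T0 : 0 <= Series (fun k => d n (S N + k)%nat)).
    { eapply Rle_trans; [|apply (series_nonneg_term_le _ 0%nat)].
      - apply Hdv.
      - intros k. apply Hdv.
      - apply (ex_series_incr_n (V := R_NormedModule) (d n) (S N)), Hd. }
    apply Rabs_lt_between. lra. }
  unfold Hnorm. fold d.
  replace (Finite 0) with (Finite (sqrt 0)) by now rewrite sqrt_0.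
  apply (is_lim_seq_continuous sqrt (fun n => Series (d n)) 0); trivial.
  apply continuity_pt_sqrt. lra.
Qed.

(** Only the zero coefficients are changed, to delta 2^{-j}; the perturbation has norm at most delta
    times that of g, which is below eps. *)
Lemma nonvanishing_dense : denseH (fun x => inH x /\ forall j, x j <> 0%C).
Proof.
  intros a Ha eps He.
  set (g := fun j => RtoC ((/ 2) ^ j)).
  assert (Hg : inH g).
  { apply (ex_series_ext (fun n => (/ 4) ^ n)).
    - intros n. unfold g. rewrite Cmod_R, pow2_abs.
      replace (/ 4) with (/ 2 * / 2) by lra. rewrite Rpow_mult_distr.
      change ((/ 2) ^ n * (/ 2) ^ n = ((/ 2) ^ n) ^ 2). ring.
    - apply ex_series_geom. rewrite Rabs_pos_eq; lra. }
  set (delta := eps / (Hnorm g + 1)).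
  pose proof (Hnorm_nonneg g) as G0.
  assert (Hdel : 0 < delta) by (apply Rdiv_lt_0_compat; lra).
  set (d := fun j => if excluded_middle_informative (a j = 0%C) then (delta * g j)%C else 0%C).
  assert (Hdg : forall j, Cmod (d j) <= Cmod (delta * g j)%C).
  { intros j. unfold d. destruct (excluded_middle_informative _); [lra|].
    rewrite Cmod_0. apply Cmod_ge_0. }
  assert (Hsg : inH (fun j => delta * g j)%C) by now apply inH_scal.
  assert (Hd : inH d) by now apply (inH_le d _ Hdg).
  assert (Hx : inH (fun j => a j + d j)%C) by now apply inH_plus.
  exists (fun j => a j + d j)%C. repeat split; trivial.
  - intros j. unfold d. destruct (excluded_middle_informative _) as [E|E].
    + rewrite E, Cplus_0_l. unfold g. rewrite <- RtoC_mult. intros E'. injection E'.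
      assert (0 < (/ 2) ^ j) by (apply pow_lt; lra). intros E''.
      pose proof (Rmult_lt_0_compat _ _ Hdel H). lra.
    + now rewrite Cplus_0_r.
  - replace (seq_sub _ a) with d
      by (extensionality j; unfold seq_sub; ring).
    eapply Rle_lt_trans; [now apply (Hnorm_le d _ Hdg)|].
    unfold Hnorm at 1.
    rewrite (Series_ext _ (fun n => delta ^ 2 * Cmod (g n) ^ 2)).
    2:{ intros n. rewrite Cmod_mult, Rpow_mult_distr, Cmod_R, pow2_abs. reflexivity. }
    rewrite Series_scal_l, sqrt_mult_alt by apply pow2_ge_0.
    rewrite sqrt_pow2 by lra. fold (Hnorm g).
    assert (E : eps = delta * (Hnorm g + 1)) by (unfold delta; field; lra).
    rewrite E. nra.
Qed.

(** * The diagonal unitary operator of a vertical translation *)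

Section Translation.
Context (phi : C -> C) (T : seqC -> seqC) (t : R)
  (Hphi : forall s, in_halfplane (1/2) s -> phi s = (s + (0, t))%C)
  (HT : is_bounded_composition_operator phi T).

Lemma Cmod_npow_neg_imag j : Cmod (npow_neg (S j) (0, t)) = 1.
Proof. rewrite Cmod_npow_neg. cbn [Re fst]. now rewrite Ropp_0, Rmult_0_l, exp_0. Qed.

Lemma translation_T a j : inH a -> T a j = (npow_neg (S j) (0, t) * a j)%C.
Proof.
  intros Ha.
  apply (dirichlet_unique (T a) (fun j => npow_neg (S j) (0, t) * a j)%C).
  - now apply (inH_T phi T HT).
  - apply (inH_le _ a); trivial. intros n.
    rewrite Cmod_mult, Cmod_npow_neg_imag. lra.
  - intros x Hx. apply in_halfplane_real in Hx.
    assert (Hx' : in_halfplane (1/2) (phi x)).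
    { rewrite Hphi by trivial. unfold in_halfplane in *. rewrite re_plus. cbn in *. lra. }
    destruct (dirichlet_ex_value a _ Ha Hx') as [v Hv].
    exists v. split; [now apply HT|].
    revert Hv. rewrite Hphi by trivial. apply Cseries_ext.
    intros n. rewrite npow_neg_plus. ring.
Qed.

Lemma translation_iter k a j :
  inH a -> Nat.iter k T a j = (npow_neg (S j) (0, t) ^ k * a j)%C.
Proof.
  intros Ha. induction k as [|k IH]; [simpl; ring|].
  change (Nat.iter (S k) T a) with (T (Nat.iter k T a)).
  rewrite translation_T, IH, Cpow_S by now apply (inH_iter_T phi T HT). ring.
Qed.

Lemma translation_conv_along w :
  (forall j, is_lim_seq (fun n => Cmod (npow_neg (S j) (0, t) ^ w n - 1)%C) 0) ->
  forall a, inH a -> conv_along T w a.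
Proof.
  intros Hw a Ha.
  apply (is_lim_seq_ext (fun n => Hnorm (fun j => (npow_neg (S j) (0, t) ^ w n - 1) * a j)%C)).
  - intros n. f_equal. extensionality j. unfold seq_sub.
    rewrite translation_iter by trivial. ring.
  - apply (Hnorm_multiplier_lim (fun n j => npow_neg (S j) (0, t) ^ w n - 1)%C); trivial.
    intros n j. unfold Cminus. eapply Rle_trans; [apply Cmod_triangle|].
    rewrite Cmod_m1, Cmod_pow, Cmod_npow_neg_imag, pow1. lra.
Qed.

Lemma translation_Hr x : inH x -> (forall j, x j <> 0%C) -> Hr T x.
Proof.
  intros Hx Hnz. split.
  - split; trivial.
    destruct (unimodular_recurrence (fun j => npow_neg (S j) (0, t)) Cmod_npow_neg_imag)
      as (w & Hw & Hl).
    exists w. split; trivial. now apply translation_conv_along.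
  - intros w _ [_ Hc] a Ha eps He.
    (* Dividing coefficient j of the return error by |x_j| shows that each eigenvalue power tends to
       1. So every vector converges along w, and a approximates itself. *)
    exists a. repeat split; trivial.
    + apply translation_conv_along; trivial. intros j.
      specialize (Hnz j). apply Cmod_gt_0 in Hnz.
      apply (is_lim_seq_le_le (fun _ => 0) _
        (fun n => Hnorm (seq_sub (Nat.iter (w n) T x) x) * / Cmod (x j))).
      * intros n. split; [apply Cmod_ge_0|].
        apply (Rmult_le_reg_r (Cmod (x j))); trivial.
        rewrite Rmult_assoc, Rinv_l, Rmult_1_r, <- Cmod_mult by lra.
        replace ((npow_neg (S j) (0, t) ^ w n - 1) * x j)%C
          with (seq_sub (Nat.iter (w n) T x) x j)
          by (unfold seq_sub; rewrite translation_iter by trivial; ring).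
        apply coef_le_Hnorm, inH_seq_sub; trivial. now apply (inH_iter_T phi T HT).
      * apply is_lim_seq_const.
      * replace 0 with (0 * / Cmod (x j)) by ring.
        apply is_lim_seq_mult'; [exact Hc|apply is_lim_seq_const].
    + replace (Hnorm (seq_sub a a)) with 0; trivial.
      unfold Hnorm. rewrite (Series_ext _ (fun _ => 0 * 0)).
      * rewrite Series_scal_l, Rmult_0_l. now rewrite sqrt_0.
      * intros n. unfold seq_sub. replace (a n - a n)%C with (RtoC 0) by ring.
        rewrite Cmod_0. ring.
Qed.

Lemma translation_dense_Hr : denseH (Hr T).
Proof.
  intros a Ha eps He. destruct (nonvanishing_dense a Ha eps He) as (x & [Hx Hnz] & _ & Hd).
  exists x. repeat split; trivial; now apply translation_Hr.
Qed.

End Translation.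

Theorem theorem5p21 (phi : C -> C) (T : seqC -> seqC)
  (Hphi_hol : holomorphic_on_half phi)
  (Hphi_maps : forall s, in_halfplane (1/2) s -> in_halfplane (1/2) (phi s))
  (HT : is_bounded_composition_operator phi T) :
  (recurrent T <->
     exists t : R, forall s, in_halfplane (1/2) s -> phi s = Cplus s (0, t)) /\
  (recurrent T -> hyper_recurrent T /\ denseH (Hr T)).
Proof.
  assert (Dense : (exists t : R, forall s, in_halfplane (1/2) s -> phi s = Cplus s (0, t)) ->
    denseH (Hr T)).
  { intros [t Ht]. exact (translation_dense_Hr phi T t Ht HT). }
  repeat split.
  - now apply (recurrent_translation phi T).
  - intros Ht a Ha eps He. destruct (Dense Ht a Ha eps He) as (x & [Hx _] & Hd).
    now exists x.
  - trivial.
  (* Density near any one vector already yields an element of Hr. *)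
  - destruct (Dense (recurrent_translation phi T Hphi_maps HT H) _ (inH_unit_seq 0) 1 Rlt_0_1)
      as (x & Hx & _).
    now exists x.
  - apply Dense. now apply (recurrent_translation phi T).
Qed.
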